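(* Let $G$ be a Lie group of dimension $\bar m$ with Lie algebra $\mathfrak{g}$, let $Q=G\times\mathbb{V}^{\bar\delta}$ be the trivial principal bundle over $\mathbb{V}^{\bar\delta}$ with coordinates $r^I$ on the base, and consider the left-invariant kinematic constraints $u^\alpha=0$, $\alpha=1,\dots,\bar m$, with $$u^\alpha:=\xi^\alpha+\mathcal{A}_I^\alpha(r)\,\dot r^I,$$ where $\hat\xi=g^{-1}\dot g\in\mathfrak{g}$ has components $\xi^\alpha$ and $\mathcal{A}_I^\alpha$ are smooth functions of $r=(r^I)$. Then the Hamel coefficients $$\gamma_{IJ}^\alpha=\frac{\partial\mathcal{A}_I^\alpha}{\partial r^J}-\frac{\partial\mathcal{A}_J^\alpha}{\partial r^I}+c_{\lambda\mu}^\alpha\mathcal{A}_I^\lambda\mathcal{A}_J^\mu,\qquad \alpha=1,\dots,\bar m,$$ of the quasi-velocities $(u^\alpha,u^I:=\dot r^I)$ are the components $\mathcal{B}_{IJ}^\alpha$ of the curvature of the kinematic connection, in bundle coordinates $(\xi^\alpha,\dot r^I)$ on the left-trivialized principal bundle: $\mathcal{B}_{IJ}^\alpha=\gamma_{IJ}^\alpha$. Moreover, the connection is flat if and only if the constraints are holonomic.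
   Context: Repeated indices are summed. $n=\bar m+\bar\delta$; Greek indices run over $1,\dots,\bar m$, capital Latin indices $I,J$ over $\bar m+1,\dots,n$, and $a,b,c$ over $1,\dots,n$. $\mathbb{V}^{\bar\delta}$ is a coordinate manifold (shape space) with (local) coordinates $r^I$. A basis $(e_\alpha)$ of $\mathfrak{g}$ is fixed, $\hat\xi=\xi^\alpha e_\alpha$, and the structure constants are given by $[e_\beta,e_\lambda]=c_{\beta\lambda}^\alpha e_\alpha$. Hamel coefficients: for coordinates $q^a$ on $Q$ and quasi-velocities $u^a=A_b^a(q)\dot q^b$ with smooth invertible $(A_b^a)$ and inverse relation $\dot q^a=B_b^a(q)u^b$, they are defined by $$\gamma_{ab}^c:=\Big(\frac{\partial A_r^c}{\partial q^s}-\frac{\partial A_s^c}{\partial q^r}\Big)B_a^rB_b^s$$ (here $r,s$ are summation indices running over $1,\dots,n$). Here $q=(s^\alpha,r^I)$, with local canonical coordinates $s^\alpha$ on $G$, in which $\xi^\alpha=A_\beta^\alpha(s)\dot s^\beta$. Kinematic connection: the principal connection $\mathcal{A}^{\mathrm{kin}}=\mathrm{Ad}_g(g^{-1}dg+\mathcal{A}\,dr)$ on $Q$, where $\mathcal{A}\,dr=(\mathcal{A}_I^\alpha dr^I)$, whose horizontal space is the space of velocities satisfying the constraints; $\mathcal{A}_I^\alpha$ is its local form. The sign convention for the components of its (local) curvature in a left trivialization is $$\mathcal{B}_{IJ}^\alpha:=\frac{\partial\mathcal{A}_I^\alpha}{\partial r^J}-\frac{\partial\mathcal{A}_J^\alpha}{\partial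 r^I}+c_{\beta\lambda}^\alpha\mathcal{A}_I^\beta\mathcal{A}_J^\lambda.$$ The connection is flat if $\mathcal{B}_{IJ}^\alpha\equiv0$ for all $\alpha,I,J$. The constraints are holonomic if the Pfaffian system $u^\alpha=0$ on $Q$ is integrable, i.e. the constraint distribution $\{u^\alpha=0,\ \alpha=1,\dots,\bar m\}\subset TQ$ is integrable in the sense of Frobenius. *)

(* Defs.v *)
From HB Require Import structures.
From mathcomp Require Import all_boot all_order all_algebra.
From mathcomp Require Import all_classical all_reals all_analysis.
Import numFieldNormedType.Exports.
Set Implicit Arguments.
Unset Strict Implicit.
Unset Printing Implicit Defensive.
Import Order.TTheory GRing.Theory Num.Theory.
Local Open Scope classical_set_scope.
Local Open Scope ring_scope.

(* Coordinate vectors are row vectors; R^n is *)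
(* 'rV[R]_n, and coordinates q = (s, r) on a product are row_mx s r.          *)

Section Calculus.
Context {R : realType}.

Definition partial n (W : normedModType R) (i : 'I_n) (F : 'rV[R]_n -> W) :
    'rV[R]_n -> W :=
  'D_(delta_mx 0 i) F.

Fixpoint Ck_on n (W : normedModType R) (k : nat) (U : set 'rV[R]_n)
    (F : 'rV[R]_n -> W) : Prop :=
  match k with
  | 0 => {in U, continuous F}
  | k'.+1 => (forall x, U x -> differentiable F x) /\
             (forall i : 'I_n, Ck_on k' U (partial i F))
  end.

(* Meant for open U: then only the values of F on U matter. *)
Definition smooth_on n (W : normedModType R) (U : set 'rV[R]_n)
    (F : 'rV[R]_n -> W) : Prop :=
  forall k, Ck_on k U F.

(* Bracket of vector fields on an open subset of R^n:                         *)
(* [X, Y]^k = X^j d_j Y^k - Y^j d_j X^k.                                      *)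
Definition vf_bracket n (X Y : 'rV[R]_n -> 'rV[R]_n) : 'rV[R]_n -> 'rV[R]_n :=
  fun x => 'D_(X x) Y x - 'D_(Y x) X x.

End Calculus.

Section Manifold.
Context {R : realType}.

(* [point] is the inverse of [coord]; both are total functions, and their     *)
(* values outside [dom] and [cod] are irrelevant.                             *)
Record chart (M : topologicalType) (n : nat) := Chart {
  dom : set M;
  coord : M -> 'rV[R]_n;
  point : 'rV[R]_n -> M }.

Definition cod (M : topologicalType) n (k : chart M n) : set 'rV[R]_n :=
  coord k @` dom k.

Record is_chart (M : topologicalType) n (k : chart M n) : Prop := IsChart {
  open_dom : open (dom k);
  open_cod : open (cod k);
  coordK : {in dom k, cancel (coord k) (point k)};
  continuous_coord : {in dom k, continuous (coord k)};
  continuous_point : {in cod k, continuous (point k)} }.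

Definition smooth_transition (M : topologicalType) n (k k' : chart M n) : Prop :=
  smooth_on (coord k @` (dom k `&` dom k')) (coord k' \o point k).

(* [S] is a maximal smooth atlas, so that a chart in [S] means arbitrary     *)
(* local coordinates of the manifold.                                         *)
Record smooth_manifold (M : topologicalType) n (S : set (chart M n)) : Prop :=
  SmoothManifold {
  manifold_hausdorff : hausdorff_space M;
  manifold_second_countable : @second_countable M;
  atlas_chart : forall k, S k -> is_chart k;
  atlas_cover : forall p : M, exists2 k, S k & dom k p;
  atlas_compatible : forall k k', S k -> S k' -> smooth_transition k k';
  atlas_maximal : forall k, is_chart k ->
    (forall k', S k' -> smooth_transition k k' /\ smooth_transition k' k) ->
    S k }.

Definition prod_chart (M N : topologicalType) m n
    (k : chart M m) (l : chart N n) : chart (M * N)%type (m + n) :=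
  Chart (dom k `*` dom l)
        (fun p => row_mx (coord k p.1) (coord l p.2))
        (fun x => (point k (lsubmx x), point l (rsubmx x))).

(* An atlas of the product manifold. *)
Definition prod_atlas (M N : topologicalType) m n
    (S : set (chart M m)) (T : set (chart N n)) :
    set (chart (M * N)%type (m + n)) :=
  [set prod_chart k l | k in S & l in T].

Definition euclidean_atlas n : set (chart 'rV[R]_n n) :=
  [set Chart setT id id].

(* Smoothness on an open set D, read in the charts of two atlases. *)
Definition smooth_map_on (M N : topologicalType) m n
    (S : set (chart M m)) (T : set (chart N n)) (D : set M) (f : M -> N) : Prop :=
  {in D, continuous f} /\
  forall k l, S k -> T l ->
    smooth_on (coord k @` (D `&` dom k `&` f @^-1` dom l))
              (coord l \o f \o point k).

End Manifold.
Arguments chart R M n : clear implicits.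

#[short(type="topGroupType")]
HB.structure Definition TopologicalGroupBase := {G of Group G & Topological G}.

Section LieGroup.
Context {R : realType}.

Record lie_group (G : topGroupType) m (S : set (chart R G m)) : Prop := LieGroup {
  lie_manifold : smooth_manifold S;
  lie_mul_smooth :
    smooth_map_on (prod_atlas S S) S setT (fun p : G * G => (p.1 * p.2)%g);
  lie_inv_smooth : smooth_map_on S S setT (fun g : G => (g^-1)%g) }.

Variables (G : topGroupType) (m : nat).

(* From here on k0 is a chart around 1, and a vector of the Lie algebra       *)
(* g = T_1 G is given by its components v : 'rV_m with respect to k0.         *)

(* The left-invariant vector field g |-> d(L_g)_1 v, in the chart k0. *)
Definition left_invariant_field (k0 : chart R G m) (v : 'rV[R]_m) :
    'rV[R]_m -> 'rV[R]_m :=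
  fun x => 'D_v (coord k0 \o (fun h => (point k0 x * h)%g) \o point k0)
                (coord k0 1%g).

Definition lie_bracket (k0 : chart R G m) (v w : 'rV[R]_m) : 'rV[R]_m :=
  vf_bracket (left_invariant_field k0 v) (left_invariant_field k0 w)
             (coord k0 1%g).

(* The rows of E are the basis vectors e_alpha of g, and c b l a is the       *)
(* structure constant c_{b l}^a.                                              *)
Definition structure_constants (k0 : chart R G m) (E : 'M[R]_m)
    (c : 'I_m -> 'I_m -> 'I_m -> R) : Prop :=
  forall b l, lie_bracket k0 (row b E) (row l E) = \sum_a c b l a *: row a E.

(* Components xi^alpha in the basis E of g^-1 dg = d(L_{g^-1})_g (dg), where  *)
(* g has coordinates s and dg components ds in the chart k.                   *)
Definition left_velocity (k0 : chart R G m) (E : 'M[R]_m) (k : chart R G m)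
    (s ds : 'rV[R]_m) : 'rV[R]_m :=
  'D_ds (coord k0 \o (fun h => ((point k s)^-1 * h)%g) \o point k) s *m invmx E.

End LieGroup.

Section Hamel.
Context {R : realType}.
Variable n : nat.

(* A q a b stands for A^a_b(q): the upper index is the row. *)
Variable A : 'rV[R]_n -> 'M[R]_n.

Definition quasi_velocity (q dq : 'rV[R]_n) (a : 'I_n) : R :=
  \sum_b A q a b * dq 0 b.

(* gamma^c_{ab}; here B = invmx A, with B r a standing for B^r_a. *)
Definition hamel (a b c : 'I_n) (q : 'rV[R]_n) : R :=
  \sum_r \sum_s (partial s (fun x => A x c r) q - partial r (fun x => A x c s) q)
                * invmx (A q) r a * invmx (A q) s b.

End Hamel.

Section Constraints.
Context {R : realType}.
Variables (G : topGroupType) (m : nat) (V : topologicalType) (d : nat).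

(* A smooth g-valued one-form on V: w l r a i is the component w^a_i at the   *)
(* point with coordinates r in the chart l; the second clause is the change   *)
(* of coordinates rule for covectors.                                         *)
Definition smooth_one_form (T : set (chart R V d))
    (w : chart R V d -> 'rV[R]_d -> 'M[R]_(m, d)) : Prop :=
  (forall l a i, T l -> smooth_on (cod l) (fun r => w l r a i)) /\
  (forall l l' p, T l -> T l' -> dom l p -> dom l' p -> forall a i,
     w l (coord l p) a i =
     \sum_j w l' (coord l' p) a j
            * partial i (coord l' \o point l) (coord l p) 0 j).

(* Matrix of (u^alpha, u^I) = (xi^alpha + A^alpha_I(r) dr^I, dr^I) in the     *)
(* coordinates (s, r) given by the charts k of G and l of V.                  *)
Definition constraint_coframe (k0 : chart R G m) (E : 'M[R]_m)
    (A : chart R V d -> 'rV[R]_d -> 'M[R]_(m, d))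
    (k : chart R G m) (l : chart R V d) (q : 'rV[R]_(m + d)) : 'M[R]_(m + d) :=
  block_mx
    (\matrix_(a, b) left_velocity k0 E k (lsubmx q) (delta_mx 0 b) 0 a)
    (A l (rsubmx q))
    0 1%:M.

(* The fibre {u^alpha = 0} of the constraint distribution. *)
Definition constraint_space (k0 : chart R G m) (E : 'M[R]_m)
    (A : chart R V d -> 'rV[R]_d -> 'M[R]_(m, d))
    (k : chart R G m) (l : chart R V d) (q : 'rV[R]_(m + d)) :
    set 'rV[R]_(m + d) :=
  [set dq | forall a : 'I_m,
     quasi_velocity (constraint_coframe k0 E A k l) q dq (lshift d a) = 0].

(* Integrability of the constraint distribution: through every point of Q     *)
(* passes an integral manifold, i.e. an immersed submanifold f(W) of Q        *)
(* tangent to the distribution, of full dimension d. That f is an immersion   *)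
(* follows from the equality of tangent spaces, as {u^alpha = 0} has          *)
(* dimension d.                                                               *)
Definition holonomic (S : set (chart R G m)) (T : set (chart R V d))
    (k0 : chart R G m) (E : 'M[R]_m)
    (A : chart R V d -> 'rV[R]_d -> 'M[R]_(m, d)) : Prop :=
  forall p : G * V, exists (W : set 'rV[R]_d) (f : 'rV[R]_d -> G * V),
    [/\ open W,
        exists2 x, W x & f x = p,
        {in W &, injective f},
        smooth_map_on (@euclidean_atlas R d) (prod_atlas S T) W f &
        forall x k l, W x -> S k -> T l -> dom (prod_chart k l) (f x) ->
          range (fun v : 'rV[R]_d => 'D_v (coord (prod_chart k l) \o f) x) =
          constraint_space k0 E A k l (coord (prod_chart k l) (f x))].

(* B^a_{ij} in the chart l. With Ad_g(g^-1 dg + A dr) as connection form,     *)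
(* this is minus its curvature two-form, read in the left trivialization.     *)
Definition curvature (c : 'I_m -> 'I_m -> 'I_m -> R)
    (A : chart R V d -> 'rV[R]_d -> 'M[R]_(m, d)) (l : chart R V d)
    (a : 'I_m) (i j : 'I_d) (r : 'rV[R]_d) : R :=
  partial j (fun x => A l x a i) r - partial i (fun x => A l x a j) r
  + \sum_b \sum_e c b e a * A l r b i * A l r e j.

Definition flat (T : set (chart R V d)) (c : 'I_m -> 'I_m -> 'I_m -> R)
    (A : chart R V d -> 'rV[R]_d -> 'M[R]_(m, d)) : Prop :=
  forall l r, T l -> cod l r -> forall a i j, curvature c A l a i j r = 0.

End Constraints.

(* Main.v *)
From HB Require Import structures.
From Pilot Require Import Defs.
From mathcomp Require Import all_boot all_order all_algebra.
From mathcomp Require Import all_classical all_reals all_analysis.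
From mathcomp Require Import ring lra.
Import numFieldNormedType.Exports.
Import Order.TTheory GRing.Theory Num.Theory.
Import Pilot.Defs.
Local Open Scope classical_set_scope.
Local Open Scope ring_scope.
Set Implicit Arguments.
Unset Strict Implicit.
Unset Printing Implicit Defensive.

(* Write the constraints as [u = theta E^-1 + A dr], where [theta = g^-1 dg].  *)
(* The Maurer-Cartan equation expresses [d theta] through the bracket of [g],  *)
(* so on two vectors annihilated by [u] the form [- du] is the curvature of    *)
(* their base components; the columns of the inverse coframe with index in the *)
(* base are such vectors, which gives the Hamel coefficients.                  *)
(* If the constraints are holonomic, [u] pulls back to [0] on an integral      *)
(* manifold, hence so does [du], and the curvature vanishes.  Conversely, if   *)
(* the curvature vanishes then horizontality [dg = - g A dr] is an integrable  *)
(* total differential equation; it is solved along the rays from the base      *)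
(* point, and integrability makes the endpoint map of these solutions          *)
(* differentiable with the right differential.                                 *)

(** * Differentials *)

(** Forms are encoded as matrices acting on row vectors, and everything is read off from minus the
    exterior derivative, [ext_form], of the constraint form u on pairs of vectors killed by u. On
    such vectors theta = - (A dr) E, so the Maurer-Cartan equation ([maurer_cartan]) turns the theta
    part of - du into c A A, the two signs cancelling, while the A part contributes the
    antisymmetrized derivative of A: this is the curvature ([ext_constraint_form]). Hamel
    coefficients are minus the exterior derivative of the coframe on columns of its inverse
    ([hamel_ext_form]); the columns with base indices are killed by u and project to the coordinate
    vectors of the base, whence [hamel_curvature].

    The Maurer-Cartan equation holds at 1 because the differential of left translation and its
    inverse are both the identity matrix there, so their derivatives are opposite. It spreads over G
    because theta is left invariant and the exterior derivative commutes with pullback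
    ([ext_form_pullback]), which is the symmetry of second derivatives.

    Holonomic implies flat ([holonomic_flat]): on an integral manifold through the identity over r,
    both u and du pull back to 0, and every horizontal lift is tangent to it, so the curvature
    vanishes at r.

    Flat implies holonomic ([flat_holonomic]): differentiating the identity that u kills a
    horizontal frame shows that ds = dr F(s, r) is integrable ([flat_integrable]). [frobenius]
    solves this equation. Picard iteration ([ode_exists]) gives solutions along the rays from the
    base point, and [ray_increment] bounds by a multiple of |h|^2 the gap between the change of
    endpoint caused by h and its prediction h F. The endpoint map is therefore differentiable with
    differential F, smooth by bootstrapping ([total_differential_smooth]), and its graph is the
    integral manifold. *)

Section Differentials.
Context {R : realType}.

Lemma norm_entry_le p q (M : 'M[R]_(p, q)) i j : `|M i j| <= `|M|.
Proof.
rewrite [leRHS]/Num.Def.normr/= mx_normrE.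
exact: (le_bigmax _ (fun ij : 'I_p * 'I_q => `|M ij.1 ij.2|) (i, j)).
Qed.

Lemma mx_norm_le p q (M : 'M[R]_(p, q)) e :
  0 <= e -> (forall i j, `|M i j| <= e) -> `|M| <= e.
Proof.
by move=> e0 Me; rewrite /Num.Def.normr/= mx_normrE bigmax_le// => -[i j] _.
Qed.

Lemma rV_delta_sum n (x : 'rV[R]_n) : x = \sum_j x 0 j *: delta_mx 0 j.
Proof.
by rewrite {1}[x]matrix_sum_delta big_ord1.
Qed.

Lemma linear_rV_sum n (W : lmodType R) (L : {linear 'rV[R]_n -> W}) x :
  L x = \sum_j x 0 j *: L (delta_mx 0 j).
Proof.
by rewrite {1}[x]rV_delta_sum linear_sum; apply: eq_bigr => j _; rewrite linearZ.
Qed.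

Lemma linear_rV_continuous n (W : normedModType R) (L : {linear 'rV[R]_n -> W}) :
  continuous L.
Proof.
rewrite (_ : (L : _ -> _) =
  fun y : 'rV_n => \sum_j y 0 j *: L (delta_mx 0 j)); last first.
  by apply/funext => y; rewrite linear_rV_sum.
apply: (@continuous_big _ _ +%R 0 predT add_continuous _ _
  (fun j (y : 'rV[R]_n) => y 0 j *: L (delta_mx 0 j))) => j _ x.
by apply: (@continuousZr_tmp R W _ (fun y : 'rV[R]_n => y 0 j)); exact: coord_continuous.
Qed.

(** The bound for every e is the little-o expansion of f at x, and uniqueness of the expansion
    identifies the candidate L with the differential. *)
Lemma diff_eps (V W : normedModType R) (f : V -> W) x (L : {linear V -> W}) :
  continuous L ->
  (forall e, 0 < e -> \forall h \near 0, `|f (h + x) - f x - L h| <= e * `|h|) ->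
  differentiable f x /\ ('d f x = L :> (V -> W)).
Proof.
move=> Lc H.
have fo : f \o shift x = cst (f x) + L +o_ 0 id.
  apply/eqaddoP => e e0; near=> h.
  rewrite !fctE opprD addrA /=; near: h; exact: H.
have dE := diff_unique Lc fo.
by split => //; apply/diff_locallyP; rewrite dE.
Unshelve. all: by end_near. Qed.

Lemma differentiable_eps (V W : normedModType R) (f : V -> W) x e :
  differentiable f x -> 0 < e ->
  \forall h \near 0, `|f (h + x) - f x - 'd f x h| <= e * `|h|.
Proof.
move=> /diff_locally /eqaddoP /(_ e) + e0 => /(_ e0) H.
near=> h; rewrite -addrA -opprD; near: h; exact: H.
Unshelve. all: by end_near. Qed.

Lemma near_eq_differentiable (V W : normedModType R) (f g : V -> W) x :
  (\forall y \near x, f y = g y) -> differentiable f x -> differentiable g x.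
Proof.
move=> fg df.
apply: (proj1 (diff_eps (L := 'd f x) (diff_continuous df) _)) => e e0.
have fg0 : \forall h \near 0, f (h + x) = g (h + x).
  by have := fg; rewrite (near_shift 0 x) /= subr0.
near=> h.
rewrite -(nbhs_singleton fg); have <- : f (h + x) = g (h + x) by near: h.
near: h; exact: differentiable_eps.
Unshelve. all: by end_near. Qed.

Lemma derive_rV n (W : normedModType R) (F : 'rV[R]_n -> W) x v :
  differentiable F x -> 'D_v F x = \sum_j v 0 j *: partial j F x.
Proof.
move=> dF; rewrite deriveE// linear_rV_sum.
by apply: eq_bigr => j _; rewrite /partial deriveE.
Qed.

(** The differentials of the entries assemble into a linear map, and the remainder is small in the
    sup norm because each of its finitely many entries is. *)
Lemma differentiable_mxP (V : normedModType R) p q (F : V -> 'M[R]_(p, q)) x :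
  differentiable F x <-> forall i j, differentiable (fun y => F y i j) x.
Proof.
split=> [dF i j|dF].
  apply: (@differentiable_comp _ _ _ _ F (fun M : 'M[R]_(p, q) => M i j)) => //.
  exact: differentiable_coord.
pose f (v : V) : 'M[R]_(p, q) :=
  \matrix_(i, j) (('d (fun y => F y i j) x : V -> R) v).
have f_lin : linear f by move=> k u v; apply/matrixP => i j; rewrite !mxE linearP.
pose L : {linear V -> 'M[R]_(p, q)} :=
  HB.pack f (GRing.isLinear.Build _ _ _ _ f f_lin).
apply: (proj1 (@diff_eps _ _ F x L _ _)).
  move=> v; apply/cvgrPdist_le => /= e e0; near=> w.
  apply: mx_norm_le; first exact: ltW.
  move=> i j; rewrite !mxE; move: i j; near: w.
  apply: filter_forall => i; apply: filter_forall => j.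
  by have /(_ v)/cvgrPdist_le := diff_continuous (dF i j); apply.
move=> e e0; near=> h.
apply: mx_norm_le; first by rewrite mulr_ge0// ltW.
move=> i j; rewrite !mxE; move: i j; near: h.
apply: filter_forall => i; apply: filter_forall => j.
exact: differentiable_eps.
Unshelve. all: by end_near. Qed.

Lemma derive_mxE (V : normedModType R) p q (F : V -> 'M[R]_(p, q)) x v i j :
  differentiable F x -> ('D_v F x) i j = 'D_v (fun y => F y i j) x.
Proof. by move=> dF; rewrite derive_mx ?mxE//; exact: diff_derivable. Qed.

Lemma deriveZdir (V W : normedModType R) (f : V -> W) x k v :
  differentiable f x -> 'D_(k *: v) f x = k *: 'D_v f x.
Proof. by move=> df; rewrite !deriveE// linearZ. Qed.

Lemma deriveDdir (V W : normedModType R) (f : V -> W) x v w :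
  differentiable f x -> 'D_(v + w) f x = 'D_v f x + 'D_w f x.
Proof. by move=> df; rewrite !deriveE// linearD. Qed.

Lemma derive_comp (U V W : normedModType R) (f : U -> V) (g : V -> W) x v :
  differentiable f x -> differentiable g (f x) ->
  'D_v (g \o f) x = 'D_('D_v f x) g (f x).
Proof.
move=> df dg; rewrite (deriveE _ (differentiable_comp df dg)) (deriveE _ df).
by rewrite (deriveE _ dg) (diff_comp df dg).
Qed.

End Differentials.

(** * Functions of class C^k *)

Lemma open_near (T : topologicalType) (U : set T) (P : T -> Prop) x :
  open U -> U x -> (forall y, U y -> P y) -> \forall y \near x, P y.
Proof. by move=> oU Ux UP; apply: filterS (open_nbhs_nbhs (conj oU Ux)). Qed.

Lemma open_eq_continuous (T T' : topologicalType) (U : set T) (f g : T -> T') x :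
  open U -> U x -> (forall y, U y -> f y = g y) ->
  {for x, continuous f} -> {for x, continuous g}.
Proof.
move=> oU Ux fg cf; suff : g y @[y --> x] --> g x by [].
rewrite -(fg x Ux); apply: cvg_trans (cf).
by apply: near_eq_cvg; exact: (open_near oU Ux).
Qed.

Lemma continuous_mx (R : realType) (T : topologicalType) p q
    (F : T -> 'M[R]_(p, q)) x :
  (forall i j, {for x, continuous (fun y => F y i j)}) -> {for x, continuous F}.
Proof.
move=> cF; apply/cvgrPdist_le => /= e e0; near=> y.
apply: mx_norm_le; first exact: ltW.
move=> i j; rewrite !mxE; move: i j; near: y.
apply: filter_forall => i; apply: filter_forall => j.
by have /cvgrPdist_le := cF i j; apply.
Unshelve. all: by end_near. Qed.

Section CkTheory.
Context {R : realType} {n : nat}.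
Implicit Types (W : normedModType R) (U : set 'rV[R]_n).

Lemma Ck_on_sub W k U U' (F : 'rV[R]_n -> W) :
  U `<=` U' -> Ck_on k U' F -> Ck_on k U F.
Proof.
move=> UU'; elim: k F => [|k IH] F /=.
  by move=> cF x /set_mem xU; apply: cF; exact/mem_set/UU'.
by move=> [dF pF]; split=> [x /UU' /dF//|i]; exact: IH.
Qed.

(** [Ck_on] imposes conditions at the points of the set only, on total functions; it can thus be
    checked on singletons, which makes smoothness a local notion. *)
Lemma Ck_on_point W k U (F : 'rV[R]_n -> W) :
  (forall x, U x -> Ck_on k [set x] F) -> Ck_on k U F.
Proof.
elim: k F => [|k IH] F /= H.
  by move=> x /set_mem xU; apply: (H x xU); exact/mem_set.
split=> [x xU|i]; first by have [dF _] := H x xU; exact: dF.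
by apply: IH => x xU; have [_] := H x xU.
Qed.

Lemma Ck_onS W k U (F : 'rV[R]_n -> W) : Ck_on k.+1 U F -> Ck_on k U F.
Proof.
elim: k F => [|k IH] F [dF pF].
  by move=> x /set_mem xU; apply: differentiable_continuous; exact: dF.
by split=> // i; exact: IH.
Qed.

Lemma Ck_on_eq W k U (F G : 'rV[R]_n -> W) : open U ->
  (forall x, U x -> F x = G x) -> Ck_on k U F -> Ck_on k U G.
Proof.
move=> oU; elim: k F G => [|k IH] F G FG.
  move=> cF x xU; have Ux := set_mem xU.
  apply: open_eq_continuous (oU) (Ux) FG _; exact: cF.
move=> [dF pF].
have nFG x : U x -> \forall y \near x, F y = G y.
  by move=> Ux; exact: (open_near oU Ux).
split=> [x Ux|i]; first exact: near_eq_differentiable (nFG x Ux) (dF x Ux).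
apply: IH (pF i) => x Ux; rewrite /partial; apply: near_eq_derive; exact: nFG.
Qed.

Lemma Ck_on_mxP k U p q (F : 'rV[R]_n -> 'M[R]_(p, q)) : open U ->
  Ck_on k U F <-> forall i j, Ck_on k U (fun x => F x i j).
Proof.
move=> oU; elim: k F => [|k IH] F /=; split.
- move=> cF i j x xU.
  exact: (continuous_comp (cF x xU) (@coord_continuous R p q i j (F x))).
- by move=> cF x xU; apply: continuous_mx => i j; exact: cF.
- move=> [dF pF] i j; split=> [x Ux|l].
    by have /differentiable_mxP := dF x Ux; apply.
  apply: Ck_on_eq oU _ ((IH (partial l F)).1 (pF l) i j) => x Ux.
  by rewrite /partial derive_mxE//; exact: dF.
- move=> cF.
  have dF x : U x -> differentiable F x.
    by move=> Ux; apply/differentiable_mxP => i j; have [dF _] := cF i j; exact: dF.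
  split=> // l; apply/IH => i j; have [_ /(_ l)] := cF i j.
  by apply: Ck_on_eq => // x Ux; rewrite /partial derive_mxE//; exact: dF.
Qed.

Lemma Ck_on_cst W k U (c : W) : Ck_on k U (cst c : 'rV[R]_n -> W).
Proof.
elim: k c => [|k IH] c; first by move=> x _; exact: cst_continuous.
split=> [x _|i]; first exact: differentiable_cst.
rewrite (_ : partial i (cst c) = cst 0); first exact: IH.
by apply/funext => x; rewrite /partial derive_cst.
Qed.

Lemma Ck_on_coord k U (j : 'I_n) : Ck_on k U (fun x : 'rV[R]_n => x 0 j : R).
Proof.
case: k => [|k]; first by move=> x _; exact: coord_continuous.
split=> [x _|i]; first exact: differentiable_coord.
have E : partial i (fun x : 'rV[R]_n => x 0 j : R) = cst ((delta_mx 0 i : 'rV[R]_n) 0 j).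
  apply/funext => x; rewrite /partial -(derive_mxE (F := id))//.
  by rewrite derive_id.
rewrite E; exact: Ck_on_cst.
Qed.

Lemma Ck_onD W k U (F G : 'rV[R]_n -> W) : open U ->
  Ck_on k U F -> Ck_on k U G -> Ck_on k U (fun x => F x + G x).
Proof.
move=> oU; elim: k F G => [|k IH] F G.
  by move=> cF cG x xU; exact: (continuousD (cF x xU) (cG x xU)).
move=> [dF pF] [dG pG]; split=> [x Ux|i].
  by apply: differentiableD; [exact: dF|exact: dG].
apply: Ck_on_eq oU _ (IH _ _ (pF i) (pG i)) => x Ux.
by rewrite /partial deriveD//; apply: diff_derivable; [exact: dF|exact: dG].
Qed.

Lemma Ck_onM k U (f g : 'rV[R]_n -> R) : open U ->
  Ck_on k U f -> Ck_on k U g -> Ck_on k U (fun x => f x * g x).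
Proof.
move=> oU; elim: k f g => [|k IH] f g.
  by move=> cF cG x xU; exact: (continuousM (cF x xU) (cG x xU)).
(* The product rule keeps one factor undifferentiated, and the induction needs that factor one class
   lower. *)
move=> cf cg; have cf' := Ck_onS cf; have cg' := Ck_onS cg.
move: cf cg => [df pf] [dg pg]; split=> [x Ux|i].
  by apply: differentiableM; [exact: df|exact: dg].
apply: Ck_on_eq oU _ (Ck_onD oU (IH _ _ cf' (pg i)) (IH _ _ cg' (pf i))) => x Ux.
rewrite /partial (deriveM (diff_derivable (df x Ux)) (diff_derivable (dg x Ux))).
by [].
Qed.

Lemma Ck_on_sum W (I : Type) (r : seq I) (P : pred I) k U (F : I -> 'rV[R]_n -> W) :
  open U -> (forall i, P i -> Ck_on k U (F i)) ->
  Ck_on k U (fun x => \sum_(i <- r | P i) F i x).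
Proof.
move=> oU cF; elim: r => [|i r IH].
  by apply: Ck_on_eq oU _ (Ck_on_cst k U (0 : W)) => x _; rewrite big_nil.
case Pi: (P i); last by apply: Ck_on_eq oU _ IH => x _; rewrite big_cons Pi.
by apply: Ck_on_eq oU _ (Ck_onD oU (cF i Pi) IH) => x _; rewrite big_cons Pi.
Qed.

End CkTheory.

(** By the chain rule a partial derivative of the composite is a sum of products of
    [partial j F \o G] with entries of [partial i G], which are one class lower, so induction on k
    closes. *)
Lemma Ck_on_comp {R : realType} n p k (U : set 'rV[R]_n) (V : set 'rV[R]_p)
    (G : 'rV[R]_n -> 'rV[R]_p) (F : 'rV[R]_p -> R) :
  open U -> (forall x, U x -> V (G x)) ->
  Ck_on k U G -> Ck_on k V F -> Ck_on k U (F \o G).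
Proof.
move=> oU GV; elim: k F => [|k IH] F cG.
  move=> cF x xU; apply: (continuous_comp (cG x xU)).
  by apply: cF; apply/mem_set/GV/set_mem.
have cG' := Ck_onS cG; case: (cG) => dG pG [dF pF].
have dFG x : U x -> differentiable (F \o G) x.
  by move=> Ux; apply: differentiable_comp; [exact: dG|exact/dF/GV].
split=> // i.
pose H x := \sum_j (partial j F \o G) x * (partial i G x) 0 j.
apply: (@Ck_on_eq _ _ _ _ _ H _ oU) => [x Ux|].
  rewrite /H /partial (derive_comp _ (dG x Ux) (dF _ (GV x Ux))).
  rewrite (derive_rV _ (dF _ (GV x Ux))); apply: eq_bigr => j _.
  by rewrite mulrC.
apply: Ck_on_sum => // j _; apply: Ck_onM => //; first exact: (IH (partial j F) cG' (pF j)).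
exact: ((Ck_on_mxP _ _ oU).1 (pG i)).
Qed.

Lemma near_open (T : topologicalType) (P : T -> Prop) (x : T) :
  (\forall y \near x, P y) -> exists U, [/\ open U, U x & forall y, U y -> P y].
Proof.
by move=> xP; have : nbhs x P := xP; rewrite nbhsE => -[U [oU Ux] UP]; exists U.
Qed.

Lemma near_all (T : topologicalType) (P : T -> Prop) (x : T) :
  (forall y, P y) -> \forall y \near x, P y.
Proof. exact: nearW. Qed.

Lemma near_imp (T : topologicalType) (P Q : T -> Prop) (x : T) :
  (forall y, P y -> Q y) -> (\forall y \near x, P y) -> \forall y \near x, Q y.
Proof. exact: filterS. Qed.

Lemma near_and (T : topologicalType) (P Q : T -> Prop) (x : T) :
  (\forall y \near x, P y) -> (\forall y \near x, Q y) ->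
  \forall y \near x, P y /\ Q y.
Proof. by move=> xP xQ; near do split. Unshelve. all: by end_near. Qed.

Lemma near_forall (T : topologicalType) (I : finType) (P : I -> T -> Prop) (x : T) :
  (forall i, \forall y \near x, P i y) -> \forall y \near x, forall i, P i y.
Proof. exact: filter_forall. Qed.

(** * Smoothness near a point *)

Section SmoothNear.
Context {R : realType}.

(** Smoothness is required at every point of a neighbourhood: this yields an open set on which F is
    smooth, and the property passes to nearby points. *)
Definition smooth_near n (W : normedModType R) (F : 'rV[R]_n -> W) (x : 'rV[R]_n) :=
  \forall y \near x, smooth_on [set y] F.

Lemma smooth_near_on n (W : normedModType R) (U : set 'rV[R]_n) (F : 'rV[R]_n -> W) :
  (forall x, U x -> smooth_near F x) -> smooth_on U F.
Proof. by move=> UF k; apply: Ck_on_point => x /UF /nbhs_singleton; exact. Qed.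

Lemma open_smooth_near n (W : normedModType R) (U : set 'rV[R]_n)
    (F : 'rV[R]_n -> W) x :
  open U -> U x -> smooth_on U F -> smooth_near F x.
Proof.
by move=> oU Ux UF; apply: (open_near oU Ux) => y Uy k; apply: Ck_on_sub (UF k) => z ->.
Qed.

Lemma smooth_nearP n (W : normedModType R) (F : 'rV[R]_n -> W) x :
  smooth_near F x <-> exists U, [/\ open U, U x & smooth_on U F].
Proof.
split=> [|[U [oU Ux UF]]]; last exact: open_smooth_near UF.
move=> /near_open[U [oU Ux UF]]; exists U; split => //.
by move=> k; apply: Ck_on_point => y /UF; exact.
Qed.

Lemma smooth_near_near n (W : normedModType R) (F : 'rV[R]_n -> W) x :
  smooth_near F x -> \forall y \near x, smooth_near F y.
Proof.
move=> /smooth_nearP[U [oU Ux UF]]; apply: (open_near oU Ux) => y Uy.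
exact: open_smooth_near UF.
Qed.

Lemma smooth_near_diff n (W : normedModType R) (F : 'rV[R]_n -> W) x :
  smooth_near F x -> differentiable F x.
Proof. by move=> /nbhs_singleton /(_ 1%N) [dF _]; exact: dF. Qed.

Lemma smooth_near_continuous n (W : normedModType R) (F : 'rV[R]_n -> W) x :
  smooth_near F x -> {for x, continuous F}.
Proof. by move/smooth_near_diff/differentiable_continuous. Qed.

Lemma smooth_near_eq n (W : normedModType R) (F G : 'rV[R]_n -> W) x :
  (\forall y \near x, F y = G y) -> smooth_near F x -> smooth_near G x.
Proof.
move=> /near_open[U [oU Ux FG]] /smooth_nearP[V [oV Vx VF]].
have oUV : open (U `&` V) by exact: openI.
apply/smooth_nearP; exists (U `&` V); split => // k.
apply: (@Ck_on_eq _ _ _ _ _ F) => //; first by move=> y [/FG].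
by apply: Ck_on_sub (VF k) => y [].
Qed.

Lemma smooth_near_cst n (W : normedModType R) (c : W) (x : 'rV[R]_n) :
  smooth_near (cst c) x.
Proof. by apply: near_all => y k; exact: Ck_on_cst. Qed.

Lemma smooth_near_coord n (x : 'rV[R]_n) j :
  smooth_near (fun y : 'rV[R]_n => y 0 j : R) x.
Proof. by apply: near_all => y k; exact: Ck_on_coord. Qed.

Lemma smooth_nearD n (W : normedModType R) (F G : 'rV[R]_n -> W) x :
  smooth_near F x -> smooth_near G x -> smooth_near (fun y => F y + G y) x.
Proof.
move=> /smooth_nearP[U [oU Ux UF]] /smooth_nearP[V [oV Vx VG]].
have oUV : open (U `&` V) by exact: openI.
apply/smooth_nearP; exists (U `&` V); split => // k.
apply: Ck_onD => //.
  by apply: Ck_on_sub (UF k) => y [].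
by apply: Ck_on_sub (VG k) => y [].
Qed.

Lemma smooth_nearM n (F G : 'rV[R]_n -> R) x :
  smooth_near F x -> smooth_near G x -> smooth_near (fun y => F y * G y) x.
Proof.
move=> /smooth_nearP[U [oU Ux UF]] /smooth_nearP[V [oV Vx VG]].
have oUV : open (U `&` V) by exact: openI.
apply/smooth_nearP; exists (U `&` V); split => // k.
apply: Ck_onM => //.
  by apply: Ck_on_sub (UF k) => y [].
by apply: Ck_on_sub (VG k) => y [].
Qed.

Lemma smooth_near_sum n (W : normedModType R) (I : Type) (r : seq I) (P : pred I)
    (F : I -> 'rV[R]_n -> W) x :
  (forall i, P i -> smooth_near (F i) x) ->
  smooth_near (fun y => \sum_(i <- r | P i) F i y) x.
Proof.
move=> sF; elim: r => [|i r IH].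
  by apply: smooth_near_eq (smooth_near_cst (0 : W) x); apply: near_all => y; rewrite big_nil.
case Pi: (P i).
  apply: smooth_near_eq (smooth_nearD (sF i Pi) IH).
  by apply: near_all => y; rewrite big_cons Pi.
by apply: smooth_near_eq IH; apply: near_all => y; rewrite big_cons Pi.
Qed.

Lemma smooth_near_mxP n p q (F : 'rV[R]_n -> 'M[R]_(p, q)) x :
  smooth_near F x <-> forall i j, smooth_near (fun y => F y i j) x.
Proof.
split=> [/smooth_nearP[U [oU Ux UF]] i j|sF].
  apply: (open_smooth_near oU Ux) => k; exact: ((Ck_on_mxP k F oU).1 (UF k)).
have : \forall y \near x, forall i j, smooth_near (fun y => F y i j) y.
  apply: near_forall => i; apply: near_forall => j; exact: smooth_near_near.
move=> /near_open[U [oU Ux UF]].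
apply: (open_smooth_near oU Ux) => k; apply/Ck_on_mxP => // i j.
by apply: smooth_near_on => y /UF.
Qed.

Lemma smooth_near_comp1 n p (G : 'rV[R]_n -> 'rV[R]_p) (F : 'rV[R]_p -> R) x :
  smooth_near G x -> smooth_near F (G x) -> smooth_near (F \o G) x.
Proof.
move=> sG /smooth_nearP[V [oV Vx VF]].
have : \forall y \near x, smooth_near G y /\ V (G y).
  apply: near_and; first exact: smooth_near_near.
  by apply: (smooth_near_continuous sG); exact: open_nbhs_nbhs.
move=> /near_open[U [oU Ux UG]].
apply: (open_smooth_near oU Ux) => k; apply: (Ck_on_comp oU _ _ (VF k)).
  by move=> y /UG[].
by apply: smooth_near_on => y /UG[].
Qed.

Lemma smooth_near_comp n p q r (G : 'rV[R]_n -> 'rV[R]_p)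
    (F : 'rV[R]_p -> 'M[R]_(q, r)) x :
  smooth_near G x -> smooth_near F (G x) -> smooth_near (F \o G) x.
Proof.
move=> sG /smooth_near_mxP sF; apply/smooth_near_mxP => i j.
exact: (smooth_near_comp1 sG (sF i j)).
Qed.

Lemma smooth_near_partial n (W : normedModType R) (F : 'rV[R]_n -> W) x i :
  smooth_near F x -> smooth_near (partial i F) x.
Proof. by apply: near_imp => y sF k; have [_] := sF k.+1; apply. Qed.

Lemma smooth_near_derive n (F : 'rV[R]_n -> R) (v : 'rV[R]_n -> 'rV[R]_n) x :
  smooth_near F x -> smooth_near v x -> smooth_near (fun y => 'D_(v y) F y) x.
Proof.
move=> sF /smooth_near_mxP sv.
apply: (@smooth_near_eq _ _ (fun y => \sum_j v y 0 j * partial j F y)).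
  apply: near_imp (smooth_near_near sF) => y /smooth_near_diff dF.
  by rewrite derive_rV.
by apply: smooth_near_sum => j _; apply: smooth_nearM => //; exact: smooth_near_partial.
Qed.

Lemma smooth_near_derive_mx n p q (F : 'rV[R]_n -> 'M[R]_(p, q))
    (v : 'rV[R]_n -> 'rV[R]_n) x :
  smooth_near F x -> smooth_near v x -> smooth_near (fun y => 'D_(v y) F y) x.
Proof.
move=> sF sv; apply/smooth_near_mxP => i j.
apply: (@smooth_near_eq _ _ (fun y => 'D_(v y) (fun z => F z i j) y)).
  apply: near_imp (smooth_near_near sF) => y /smooth_near_diff dF.
  by rewrite derive_mxE.
by apply: smooth_near_derive => //; have /smooth_near_mxP := sF; apply.
Qed.

Lemma smooth_near_row_mx n p q (F : 'rV[R]_n -> 'rV[R]_p) (G : 'rV[R]_n -> 'rV[R]_q) x :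
  smooth_near F x -> smooth_near G x -> smooth_near (fun y => row_mx (F y) (G y)) x.
Proof.
move=> /smooth_near_mxP sF /smooth_near_mxP sG; apply/smooth_near_mxP => i j.
case: (split_ordP j) => l ->.
  by apply: smooth_near_eq (sF i l); apply: near_all => y; rewrite row_mxEl.
by apply: smooth_near_eq (sG i l); apply: near_all => y; rewrite row_mxEr.
Qed.

Lemma smooth_near_id n (x : 'rV[R]_n) : smooth_near id x.
Proof. by apply/smooth_near_mxP => i j; rewrite ord1; exact: smooth_near_coord. Qed.

Lemma smooth_near_lsubmx p q (x : 'rV[R]_(p + q)) :
  smooth_near (lsubmx : _ -> 'rV[R]_p) x.
Proof.
apply/smooth_near_mxP => i j; rewrite ord1.
by apply: smooth_near_eq (smooth_near_coord x (lshift q j)); apply: near_all => y; rewrite mxE.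
Qed.

Lemma smooth_near_rsubmx p q (x : 'rV[R]_(p + q)) :
  smooth_near (rsubmx : _ -> 'rV[R]_q) x.
Proof.
apply/smooth_near_mxP => i j; rewrite ord1.
by apply: smooth_near_eq (smooth_near_coord x (rshift p j)); apply: near_all => y; rewrite mxE.
Qed.

Lemma smooth_near_mulmx n p q r (F : 'rV[R]_n -> 'M[R]_(p, q))
    (G : 'rV[R]_n -> 'M[R]_(q, r)) x :
  smooth_near F x -> smooth_near G x -> smooth_near (fun y => F y *m G y) x.
Proof.
move=> /smooth_near_mxP sF /smooth_near_mxP sG; apply/smooth_near_mxP => i j.
apply: (@smooth_near_eq _ _ (fun y => \sum_k F y i k * G y k j)).
  by apply: near_all => y; rewrite mxE.
by apply: smooth_near_sum => k _; exact: smooth_nearM.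
Qed.

End SmoothNear.

(** * Lines, mean values and symmetry of second derivatives *)

Section Schwarz.
Context {R : realType}.

Lemma is_derive_line (V W : normedModType R) (f : V -> W) (a u : V) (t : R) :
  differentiable f (a + t *: u) ->
  is_derive t 1 (fun s : R => f (a + s *: u)) ('D_u f (a + t *: u)).
Proof.
move=> df.
have dl : is_diff t (fun s : R => a + s *: u) (fun s => s *: u).
  have := is_diffD (is_diff_cst a t) (is_diff_scalel t u).
  by rewrite add0r.
have dl1 : differentiable (fun s : R => a + s *: u) t by exact: ex_diff.
apply: DeriveDef.
  exact/diff_derivable/(differentiable_comp dl1 df).
rewrite (derive_comp _ dl1 df); congr ('D_ _ f _).
by rewrite deriveE// diff_val scale1r.
Qed.

Lemma mvt_line (V : normedModType R) (f : V -> R) (a u : V) (h : R) :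
  0 < h -> (forall t, 0 <= t <= h -> differentiable f (a + t *: u)) ->
  exists2 t, 0 < t < h & f (a + h *: u) - f a = h * 'D_u f (a + t *: u).
Proof.
move=> h0 df.
have df' t : 0 <= t <= h -> is_derive t 1 (fun s : R => f (a + s *: u))
    ('D_u f (a + t *: u)).
  by move=> th; apply: is_derive_line; exact: df.
have [||t th fE] := @MVT _ (fun s : R => f (a + s *: u))
    (fun t => 'D_u f (a + t *: u)) 0 h h0.
- by move=> t; rewrite in_itv /= => /andP[t0 th]; apply: df'; rewrite !ltW.
- apply: derivable_within_continuous => t; rewrite in_itv /= => th.
  by have [] := df' _ th.
- exists t; first by move: th; rewrite in_itv.
  by move: fE; rewrite scale0r addr0 subr0 mulrC.
Qed.

Lemma derive_translate (V W : normedModType R) (f : V -> W) (x c v : V) :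
  differentiable f (x + c) ->
  differentiable (fun y => f (y + c)) x /\ 'D_v (fun y => f (y + c)) x = 'D_v f (x + c).
Proof.
move=> df.
have dl : is_diff x (fun z : V => z + c) id.
  by have := is_diffD (is_diff_id x) (is_diff_cst c x); rewrite addr0.
have dl1 : differentiable (fun z : V => z + c) x by exact: ex_diff.
split; first exact: (differentiable_comp dl1 df).
rewrite (derive_comp _ dl1 df); congr ('D_ _ f _).
by rewrite deriveE// diff_val.
Qed.

(** The second difference is the increment along v of y |-> f (y + h w) - f y. A mean value in the
    direction v, then one in the direction w for ['D_v f], produce the mixed derivative at a point
    of the square. *)
Lemma mvt_square (V : normedModType R) (f : V -> R) (x v w : V) (h : R) :
  0 < h ->
  (forall s t, 0 <= s <= h -> 0 <= t <= h ->
    differentiable f (x + s *: v + t *: w) /\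
    differentiable ('D_v f) (x + s *: v + t *: w)) ->
  exists s t, [/\ 0 < s < h, 0 < t < h &
    f (x + h *: v + h *: w) - f (x + h *: v) - f (x + h *: w) + f x =
    h * h * 'D_w ('D_v f) (x + s *: v + t *: w)].
Proof.
move=> h0 df; have hh : 0 <= h <= h by rewrite ltW /=.
have h00 : 0 <= (0:R) <= h by rewrite lexx ltW.
pose g y := f (y + h *: w) - f y.
have [|s sh gE] := @mvt_line V g x v h h0.
  move=> t th; apply: differentiableB.
    by have [dfy _] := df t h th hh; have [] := derive_translate 0 dfy.
  by have [+ _] := df t 0 th h00; rewrite scale0r addr0.
have sh' : 0 <= s <= h by have /andP[? ?] := sh; rewrite !ltW.
have [|t th DE] := @mvt_line V ('D_v f) (x + s *: v) w h h0.
  by move=> t th; have [] := df s t sh' th.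
exists s, t; split => //.
have -> : f (x + h *: v + h *: w) - f (x + h *: v) - f (x + h *: w) + f x =
    g (x + h *: v) - g x by rewrite /g opprB addrA [X in _ = X]addrAC.
rewrite gE -mulrA; congr (_ * _); rewrite -DE.
have [d1 _] := df s h sh' hh; have [d0 _] := df s 0 sh' h00.
rewrite scale0r addr0 in d0.
have [dt Dt] := derive_translate v d1.
by rewrite /g deriveB ?Dt//; exact: diff_derivable.
Qed.

(** The second difference is symmetric in v and w, so [mvt_square] in both orders equates the two
    mixed derivatives at two points of a small square; continuity brings both points back to x. *)
Lemma schwarz_scalar n (F : 'rV[R]_n -> R) (x v w : 'rV[R]_n) :
  smooth_near F x -> 'D_w ('D_v F) x = 'D_v ('D_w F) x.
Proof.
move=> sF.
have sD u : smooth_near ('D_u F) x.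
  exact: (smooth_near_derive sF (smooth_near_cst u x)).
have sDD u u' : smooth_near ('D_u ('D_u' F)) x.
  exact: (smooth_near_derive (sD u') (smooth_near_cst u x)).
apply/eqP; rewrite -subr_eq0 -normr_le0; apply/ler_addgt0Pl => e e0.
rewrite addr0.
have e20 : 0 < e / 2 by rewrite divr_gt0.
have cW := smooth_near_continuous (sDD w v).
have cV := smooth_near_continuous (sDD v w).
have nd G : smooth_near G x -> \forall y \near x, differentiable (G : _ -> R) y.
  by move=> sG; apply: near_imp (smooth_near_near sG) => y /smooth_near_diff.
have nc (G : 'rV[R]_n -> R) : {for x, continuous G} ->
    \forall y \near x, `|G x - G y| <= e / 2.
  by move=> cG; move/cvgrPdist_le : cG; apply.
have := near_and (near_and (nd _ sF) (near_and (nd _ (sD v)) (nd _ (sD w))))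
  (near_and (nc _ cW) (nc _ cV)).
move=> /nbhs_ballP[r /= r0 Hr].
(* With this side h (|v| + |w|) stays below r / 2, so the square lies in the ball; the added 1
   covers v = w = 0. *)
pose h := r / (2 * (`|v| + `|w| + 1)).
have N0 : 0 < `|v| + `|w| + 1 by rewrite ltr_wpDl// addr_ge0.
have h0 : 0 < h by rewrite divr_gt0// mulr_gt0.
have inb s t : 0 <= s <= h -> 0 <= t <= h -> ball x r (x + s *: v + t *: w).
  move=> /andP[s0 sh] /andP[t0 th]; rewrite -ball_normE /ball_ /=.
  rewrite -addrA opprD addNKr normrN (le_lt_trans (ler_normD _ _))// !normrZ.
  rewrite !ger0_norm//.
  have -> : r = h * (`|v| + `|w| + 1) * 2.
    by rewrite /h -(mulrA (r / _)) [_ * 2]mulrC divfK// gt_eqF// mulr_gt0.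
  rewrite (@le_lt_trans _ _ (h * (`|v| + `|w| + 1)))//.
    rewrite -addrA mulrDr lerD//; first by rewrite ler_wpM2r.
    by rewrite (@le_trans _ _ (h * `|w|)) ?ler_wpM2r// ler_wpM2l ?ltW// ltrDl.
  by rewrite ltr_pMr ?mulr_gt0// ltr1n.
have [s1 [t1 [s1h t1h E1]]] := @mvt_square _ F x v w h h0
  (fun s t sh th => let: conj (conj a (conj b _)) _ := Hr _ (inb s t sh th) in conj a b).
have inb' s t : 0 <= s <= h -> 0 <= t <= h -> ball x r (x + s *: w + t *: v).
  by move=> sh th; rewrite addrAC; exact: inb.
have [s2 [t2 [s2h t2h E2]]] := @mvt_square _ F x w v h h0
  (fun s t sh th => let: conj (conj a (conj _ b)) _ := Hr _ (inb' s t sh th) in conj a b).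
have /Hr[_ [B1 _]] : ball x r (x + s1 *: v + t1 *: w).
  by case/andP: s1h => *; case/andP: t1h => *; apply: inb; rewrite !ltW.
have /Hr[_ [_ B2]] : ball x r (x + s2 *: w + t2 *: v).
  by case/andP: s2h => *; case/andP: t2h => *; apply: inb'; rewrite !ltW.
have hh : h * h != 0 by rewrite mulf_neq0// gt_eqF.
have E : 'D_w ('D_v F) (x + s1 *: v + t1 *: w) = 'D_v ('D_w F) (x + s2 *: w + t2 *: v).
  apply: (mulfI hh); apply: etrans (esym E1) (etrans _ E2).
  by rewrite [x + _ + _]addrAC [F _ - F (x + h *: v) - _]addrAC.
have fin (a b c d : R) : `|a - c| <= e / 2 -> `|b - d| <= e / 2 -> c = d ->
    `|a - b| <= e.
  move=> ac + cd; rewrite -cd distrC => bc; rewrite (splitr e).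
  exact: le_trans (ler_distD c _ _) (lerD ac bc).
exact: fin B1 B2 E.
Qed.

Lemma schwarz n p q (F : 'rV[R]_n -> 'M[R]_(p, q)) (x v w : 'rV[R]_n) :
  smooth_near F x -> 'D_w ('D_v F) x = 'D_v ('D_w F) x.
Proof.
move=> sF; apply/matrixP => i j.
have sD u : smooth_near ('D_u F) x.
  exact: (smooth_near_derive_mx sF (smooth_near_cst u x)).
have nD u : \forall y \near x, 'D_u F y i j = 'D_u (fun z => F z i j) y.
  apply: near_imp (smooth_near_near sF) => y /smooth_near_diff dF.
  exact: derive_mxE.
have E1 := derive_mxE w i j (smooth_near_diff (sD v)).
have E2 := derive_mxE v i j (smooth_near_diff (sD w)).
have N1 := near_eq_derive w (nD v).
have N2 := near_eq_derive v (nD w).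
apply: etrans E1 (etrans N1 _); apply: esym; apply: etrans E2 (etrans N2 _).
by apply: schwarz_scalar; have /smooth_near_mxP := sF; apply.
Qed.

End Schwarz.

(** * Matrix-valued functions and one-forms *)

Section MatrixForms.
Context {R : realType}.

Lemma differentiable_mulmx (V : normedModType R) p q r (F : V -> 'M[R]_(p, q))
    (G : V -> 'M[R]_(q, r)) x :
  differentiable F x -> differentiable G x ->
  differentiable (fun y => F y *m G y) x.
Proof.
move=> /differentiable_mxP dF /differentiable_mxP dG.
apply/differentiable_mxP => i j.
have -> : (fun y => (F y *m G y) i j) =
    \sum_(k < q) ((fun y => F y i k) * (fun y => G y k j)).
  by apply/funext => y; rewrite mxE fct_sumE.
apply: differentiable_sum => k; exact: differentiableM.
Qed.

Lemma derive_mulmx (V : normedModType R) p q r (F : V -> 'M[R]_(p, q))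
    (G : V -> 'M[R]_(q, r)) x v :
  differentiable F x -> differentiable G x ->
  'D_v (fun y => F y *m G y) x = 'D_v F x *m G x + F x *m 'D_v G x.
Proof.
move=> dF dG; apply/matrixP => i j.
apply: etrans (derive_mxE v i j (differentiable_mulmx dF dG)) _.
have -> : (fun y => (F y *m G y) i j) =
    \sum_(k < q) ((fun y => F y i k) * (fun y => G y k j)).
  by apply/funext => y; rewrite mxE fct_sumE.
have /differentiable_mxP eF := dF; have /differentiable_mxP eG := dG.
rewrite derive_sum => [|k]; last exact/diff_derivable/differentiableM.
rewrite !mxE -big_split; apply: eq_bigr => k _ /=.
rewrite deriveM; [|exact: diff_derivable|exact: diff_derivable].
rewrite addrC (derive_mxE v i k dF) (derive_mxE v k j dG).
by congr (_ + _); exact: mulrC.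
Qed.

Lemma derive_mulmxr (V : normedModType R) p q r (F : V -> 'M[R]_(p, q)) (C : 'M[R]_(q, r)) x v :
  differentiable F x -> 'D_v (fun y => F y *m C) x = 'D_v F x *m C.
Proof.
move=> dF; apply: etrans (derive_mulmx v dF (differentiable_cst C x)) _.
by rewrite derive_cst mulmx0 addr0.
Qed.

Lemma derive_mulmxl (V : normedModType R) p q r (C : 'M[R]_(p, q)) (G : V -> 'M[R]_(q, r)) x v :
  differentiable G x -> 'D_v (fun y => C *m G y) x = C *m 'D_v G x.
Proof.
move=> dG; apply: etrans (derive_mulmx v (differentiable_cst C x) dG) _.
by rewrite derive_cst mul0mx add0r.
Qed.

(** Row vectors act from the left, so this is the transpose of the usual Jacobian matrix and the
    chain rule multiplies in the order of composition. *)
Definition jac n p (f : 'rV[R]_n -> 'rV[R]_p) (x : 'rV[R]_n) : 'M[R]_(n, p) :=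
  \matrix_(i, j) partial i f x 0 j.

Lemma derive_jac n p (f : 'rV[R]_n -> 'rV[R]_p) x v :
  differentiable f x -> 'D_v f x = v *m jac f x.
Proof.
move=> df; apply: etrans (derive_rV v df) _; apply/rowP => j.
by rewrite summxE mxE; apply: eq_bigr => i _; rewrite !mxE.
Qed.

Lemma smooth_near_jac n p (f : 'rV[R]_n -> 'rV[R]_p) x :
  smooth_near f x -> smooth_near (jac f) x.
Proof.
move=> sf; apply/smooth_near_mxP => i j.
apply: (@smooth_near_eq _ _ _ (fun y => partial i f y 0 j)).
  by apply: near_all => y; rewrite mxE.
have /smooth_near_mxP := smooth_near_partial i sf; exact.
Qed.

(** Both sides are the second differential of f at x on the pair v, w. *)
Lemma derive_jac_sym n p (f : 'rV[R]_n -> 'rV[R]_p) x v w :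
  smooth_near f x -> v *m 'D_w (jac f) x = w *m 'D_v (jac f) x.
Proof.
move=> sf; have dj := smooth_near_diff (smooth_near_jac sf).
have E u u' : 'D_u' (fun y => u *m jac f y) x = 'D_u' ('D_u f) x.
  apply: near_eq_derive; apply: near_imp (smooth_near_near sf) => y.
  by move=> /smooth_near_diff df; rewrite derive_jac.
rewrite -(derive_mulmxl v w dj) -(derive_mulmxl w v dj).
apply: etrans (E v w) _; apply: esym; apply: etrans (E w v) _.
exact: schwarz.
Qed.

(* The row vector [v *m M q] is the value at [v] of a vector-valued one-form   *)
(* with coefficients [M]; [ext_form] is minus its exterior derivative.         *)
Definition ext_form n p (M : 'rV[R]_n -> 'M[R]_(n, p)) (q v w : 'rV[R]_n) :
    'rV[R]_p :=
  v *m 'D_w M q - w *m 'D_v M q.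

Lemma ext_form_near n p (M N : 'rV[R]_n -> 'M[R]_(n, p)) q v w :
  (\forall x \near q, M x = N x) -> ext_form M q v w = ext_form N q v w.
Proof.
move=> MN; rewrite /ext_form.
by have -> := near_eq_derive w MN; have -> := near_eq_derive v MN.
Qed.

(** The exterior derivative commutes with pullback: the term containing second derivatives of f is
    symmetric in v and w, and drops out of the antisymmetrization. *)
Lemma ext_form_pullback n n' p (f : 'rV[R]_n' -> 'rV[R]_n)
    (M : 'rV[R]_n -> 'M[R]_(n, p)) x v w :
  smooth_near f x -> differentiable M (f x) ->
  ext_form (fun y => jac f y *m M (f y)) x v w =
  ext_form M (f x) ('D_v f x) ('D_w f x).
Proof.
move=> sf dM; have df := smooth_near_diff sf.
have dj := smooth_near_diff (smooth_near_jac sf).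
have dMf : differentiable (M \o f) x by exact: differentiable_comp.
have E u : 'D_u (fun y => jac f y *m M (f y)) x =
    'D_u (jac f) x *m M (f x) + jac f x *m 'D_('D_u f x) M (f x).
  apply: etrans (derive_mulmx u dj dMf) _; congr (_ + _ *m _).
  exact: (derive_comp u df dM).
rewrite /ext_form !E !mulmxDr !mulmxA (derive_jac_sym v w sf) opprD addrACA subrr.
by rewrite add0r (derive_jac v df) (derive_jac w df).
Qed.

Lemma ext_form_mulmxr n p q (M : 'rV[R]_n -> 'M[R]_(n, p)) (C : 'M[R]_(p, q)) x v w :
  differentiable M x ->
  ext_form (fun y => M y *m C) x v w = ext_form M x v w *m C.
Proof. by move=> dM; rewrite /ext_form !derive_mulmxr// !mulmxA mulmxBl. Qed.

Lemma derive_lsubmx n1 n2 (x v : 'rV[R]_(n1 + n2)) :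
  'D_v (lsubmx : _ -> 'rV[R]_n1) x = lsubmx v.
Proof.
apply/rowP => j; apply: etrans (derive_mxE v 0 j _) _.
  exact: differentiable_lsubmx.
have -> : (fun y : 'rV[R]_(n1 + n2) => lsubmx y 0 j) = (fun y => y 0 (lshift n2 j)).
  by apply/funext => y; rewrite mxE.
rewrite mxE; apply: etrans (esym (derive_mxE (F := id) v 0 _ _)) _; first exact: ex_diff.
by rewrite derive_id.
Qed.

Lemma derive_rsubmx n1 n2 (x v : 'rV[R]_(n1 + n2)) :
  'D_v (rsubmx : _ -> 'rV[R]_n2) x = rsubmx v.
Proof.
apply/rowP => j; apply: etrans (derive_mxE v 0 j _) _.
  exact: differentiable_rsubmx.
have -> : (fun y : 'rV[R]_(n1 + n2) => rsubmx y 0 j) = (fun y => y 0 (rshift n1 j)).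
  by apply/funext => y; rewrite mxE.
rewrite mxE; apply: etrans (esym (derive_mxE (F := id) v 0 _ _)) _; first exact: ex_diff.
by rewrite derive_id.
Qed.

Lemma differentiable_col_mx n p1 p2 q (F : 'rV[R]_n -> 'M[R]_(p1, q))
    (G : 'rV[R]_n -> 'M[R]_(p2, q)) x v :
  differentiable F x -> differentiable G x ->
  differentiable (fun y => col_mx (F y) (G y)) x /\
  'D_v (fun y => col_mx (F y) (G y)) x = col_mx ('D_v F x) ('D_v G x).
Proof.
move=> dF dG; have /differentiable_mxP eF := dF; have /differentiable_mxP eG := dG.
have dC : differentiable (fun y => col_mx (F y) (G y)) x.
  apply/differentiable_mxP => i j; case: (split_ordP i) => k ->.
    by under eq_fun do rewrite col_mxEu.
  by under eq_fun do rewrite col_mxEd.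
split=> //; apply/matrixP => i j; apply: etrans (derive_mxE v i j dC) _.
case: (split_ordP i) => k ->.
  rewrite col_mxEu; under eq_fun do rewrite col_mxEu.
  by apply: esym; exact: derive_mxE.
rewrite col_mxEd; under eq_fun do rewrite col_mxEd.
by apply: esym; exact: derive_mxE.
Qed.

Lemma differentiable_row_mx n p q1 q2 (F : 'rV[R]_n -> 'M[R]_(p, q1))
    (G : 'rV[R]_n -> 'M[R]_(p, q2)) x v :
  differentiable F x -> differentiable G x ->
  differentiable (fun y => row_mx (F y) (G y)) x /\
  'D_v (fun y => row_mx (F y) (G y)) x = row_mx ('D_v F x) ('D_v G x).
Proof.
move=> dF dG; have /differentiable_mxP eF := dF; have /differentiable_mxP eG := dG.
have dC : differentiable (fun y => row_mx (F y) (G y)) x.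
  apply/differentiable_mxP => i j; case: (split_ordP j) => k ->.
    by under eq_fun do rewrite row_mxEl.
  by under eq_fun do rewrite row_mxEr.
split=> //; apply/matrixP => i j; apply: etrans (derive_mxE v i j dC) _.
case: (split_ordP j) => k ->.
  rewrite row_mxEl; under eq_fun do rewrite row_mxEl.
  by apply: esym; exact: derive_mxE.
rewrite row_mxEr; under eq_fun do rewrite row_mxEr.
by apply: esym; exact: derive_mxE.
Qed.

(** This is the shape of the constraint form: its theta block depends on the group coordinates only
    and its A block on the base coordinates only. *)
Lemma ext_form_col_mx n1 n2 p (M : 'rV[R]_n1 -> 'M[R]_(n1, p))
    (N : 'rV[R]_n2 -> 'M[R]_(n2, p)) q v w :
  differentiable M (lsubmx q) -> differentiable N (rsubmx q) ->
  ext_form (fun x => col_mx (M (lsubmx x)) (N (rsubmx x))) q v w =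
  ext_form M (lsubmx q) (lsubmx v) (lsubmx w) +
  ext_form N (rsubmx q) (rsubmx v) (rsubmx w).
Proof.
move=> dM dN.
have dl : differentiable (lsubmx : _ -> 'rV[R]_n1) q by exact: differentiable_lsubmx.
have dr : differentiable (rsubmx : _ -> 'rV[R]_n2) q by exact: differentiable_rsubmx.
have dMl : differentiable (M \o lsubmx) q by exact: differentiable_comp.
have dNr : differentiable (N \o rsubmx) q by exact: differentiable_comp.
have E u : 'D_u (fun x => col_mx (M (lsubmx x)) (N (rsubmx x))) q =
    col_mx ('D_(lsubmx u) M (lsubmx q)) ('D_(rsubmx u) N (rsubmx q)).
  have El : 'D_u (M \o lsubmx) q = 'D_(lsubmx u) M (lsubmx q).
    by apply: etrans (derive_comp u dl dM) _; rewrite derive_lsubmx.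
  have Er : 'D_u (N \o rsubmx) q = 'D_(rsubmx u) N (rsubmx q).
    by apply: etrans (derive_comp u dr dN) _; rewrite derive_rsubmx.
  rewrite -El -Er; exact: (differentiable_col_mx u dMl dNr).2.
have H (u : 'rV[R]_(n1 + n2)) (A : 'M[R]_(n1, p)) (B : 'M[R]_(n2, p)) :
    u *m col_mx A B = lsubmx u *m A + rsubmx u *m B.
  by rewrite -{1}[u]hsubmxK mul_row_col.
by rewrite /ext_form !E !H opprD addrACA.
Qed.

Lemma differentiable_tr n p q (F : 'rV[R]_n -> 'M[R]_(p, q)) x v :
  differentiable F x ->
  differentiable (fun y => (F y)^T) x /\ 'D_v (fun y => (F y)^T) x = ('D_v F x)^T.
Proof.
move=> dF; have /differentiable_mxP eF := dF.
have dT : differentiable (fun y => (F y)^T) x.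
  by apply/differentiable_mxP => i j; under eq_fun do rewrite mxE.
split=> //; apply/matrixP => i j; apply: etrans (derive_mxE v i j dT) _.
by rewrite mxE; under eq_fun do rewrite mxE; apply: esym; exact: derive_mxE.
Qed.

Lemma mul_ext_formE n p (M : 'rV[R]_n -> 'M[R]_(n, p)) q (v w : 'rV[R]_n) c :
  differentiable M q ->
  (v *m 'D_w M q) 0 c =
  \sum_r \sum_s partial s (fun x => M x r c) q * v 0 r * w 0 s.
Proof.
move=> dM; rewrite mxE; apply: eq_bigr => r _.
have /differentiable_mxP eM := dM.
rewrite (derive_mxE w r c dM) (derive_rV w (eM r c)) mulr_sumr.
by apply: eq_bigr => s _; rewrite mulrC [w 0 s *: _]mulrC mulrAC.
Qed.

Lemma ext_formE n p (M : 'rV[R]_n -> 'M[R]_(n, p)) q (v w : 'rV[R]_n) c :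
  differentiable M q ->
  ext_form M q v w 0 c =
  \sum_r \sum_s (partial s (fun x => M x r c) q - partial r (fun x => M x s c) q)
                * v 0 r * w 0 s.
Proof.
move=> dM.
have subE (x y : 'rV[R]_p) : (x - y) 0 c = x 0 c - y 0 c by rewrite !mxE.
apply: etrans (subE _ _) _.
rewrite (mul_ext_formE v w c dM) (mul_ext_formE w v c dM).
rewrite [X in _ - X]exchange_big -sumrB; apply: eq_bigr => r _.
rewrite -sumrB; apply: eq_bigr => s _.
by rewrite !mulrBl [_ * w 0 s * v 0 r]mulrAC.
Qed.

(** The coframe has its upper index as row, while [ext_form] takes the components of the form as
    columns, hence the transposes. *)
Lemma hamel_ext_form n (C : 'rV[R]_n -> 'M[R]_n) a b c q :
  differentiable C q ->
  hamel C a b c q =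
  ext_form (fun x => (C x)^T) q (col a (invmx (C q)))^T (col b (invmx (C q)))^T 0 c.
Proof.
move=> dC; have [dT _] := differentiable_tr 0 dC.
apply: esym; apply: etrans (ext_formE _ _ c dT) _.
have tr r : (fun x => (C x)^T r c) = (fun x => C x c r).
  by apply/funext => x; rewrite mxE.
have colE r j : (col j (invmx (C q)))^T 0 r = invmx (C q) r j by rewrite !mxE.
apply: eq_bigr => r _; apply: eq_bigr => s _.
by rewrite (tr r) (tr s) (colE r a) (colE s b).
Qed.

End MatrixForms.

(** * Ordinary differential equations *)

Section ODE.
Context {R : realType}.

Lemma is_derive_mx p q (y : R -> 'M[R]_(p, q)) (t : R) dy :
  is_derive t 1 y dy <-> forall i j, is_derive t 1 (fun s => y s i j) (dy i j).
Proof.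
split=> [[dY <-] i j|H].
  apply: DeriveDef; first by move/derivable_mxP : dY; apply.
  by rewrite derive_mx// mxE.
have dY : derivable y t 1 by apply/derivable_mxP => i j; have [] := H i j.
apply: DeriveDef => //; rewrite derive_mx//; apply/matrixP => i j.
by rewrite mxE; have [_ ->] := H i j.
Qed.

(** In the sup norm it is enough to apply the scalar mean value theorem to each entry. *)
Lemma mvt_ineq p q (y dy : R -> 'M[R]_(p, q)) (C t : R) :
  (forall s : R, 0 <= s <= 1 -> is_derive s 1 y (dy s)) ->
  (forall s : R, 0 <= s <= 1 -> `|dy s| <= C) -> 0 <= t <= 1 ->
  `|y t - y 0| <= C * t.
Proof.
move=> yd dyC /andP[t0 t1].
have C0 : 0 <= C by apply: le_trans (normr_ge0 _) (dyC 0 _); rewrite lexx ler01.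
apply: mx_norm_le; first by rewrite mulr_ge0.
move=> i j; rewrite !mxE.
have yd' (s : R) : 0 <= s <= 1 -> is_derive s 1 (fun s => y s i j) (dy s i j).
  by move=> s01; exact: ((is_derive_mx _ _ _).1 (yd s s01)).
have [||s] := @MVT_segment _ (fun s => y s i j) (fun s => dy s i j) 0 t t0.
- move=> s; rewrite in_itv /= => /andP[s0 st]; apply: yd'.
  by rewrite ltW//= (le_trans (ltW st)).
- apply: derivable_within_continuous => s; rewrite in_itv /= => /andP[s0 st].
  by have [] : is_derive s 1 (fun s => y s i j) (dy s i j) by apply: yd'; rewrite s0 (le_trans st).
rewrite in_itv /= => /andP[s0 st] ->; rewrite subr0 normrM (ger0_norm t0).
rewrite ler_wpM2r// (le_trans (norm_entry_le _ i j))// dyC// s0 (le_trans st)//.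
Qed.

Lemma primitive (h : R -> R) : continuous h ->
  exists2 H : R -> R, H 0 = 0 & forall t : R, 0 <= t <= 1 -> is_derive t 1 H (h t).
Proof.
move=> hc.
(* Integrating from -1, and up to 2 below, makes 0 and 1 interior points, so that the derivative
   there is two-sided. *)
pose F (x : R) : R := (\int[lebesgue_measure]_(t in `[(-1 : R), x]) h t)%R.
exists (fun x => F x - F 0); first by rewrite subrr.
move=> t /andP[t0 t1].
have [||||dF FE] := @continuous_FTC1_closed R h (-1) t 2.
- by rewrite (le_lt_trans t1)// ltr1n.
- apply: continuous_compact_integrable; first exact: segment_compact.
  exact: continuous_subspaceT.
- by rewrite (lt_le_trans _ t0)// ltrN10.
- exact: hc.
have FD : is_derive t 1 F (h t) by apply: DeriveDef; [exact: dF|rewrite -derive1E; exact: FE].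
have := is_deriveB FD (is_derive_cst (F 0) t 1).
by rewrite subr0.
Qed.

Lemma primitive_mx p q (h : R -> 'M[R]_(p, q)) : continuous h ->
  exists2 H : R -> 'M[R]_(p, q), H 0 = 0 &
    forall t : R, 0 <= t <= 1 -> is_derive t 1 H (h t).
Proof.
move=> hc.
have /choice[H HP] : forall ij : 'I_p * 'I_q, exists H : R -> R, H 0 = 0 /\
    forall t : R, 0 <= t <= 1 -> is_derive t 1 H (h t ij.1 ij.2).
  move=> [i j]; have [|H H0 HD] := @primitive (fun t => h t i j).
    move=> t; exact: (continuous_comp (hc t) (@coord_continuous R p q i j (h t))).
  by exists H.
exists (fun t => \matrix_(i, j) H (i, j) t).
  by apply/matrixP => i j; rewrite !mxE; have [] := HP (i, j).
move=> t t01; apply/is_derive_mx => i j.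
have [_ /(_ t t01)] := HP (i, j).
suff -> : (fun s => (\matrix_(i, j) H (i, j) s) i j) = H (i, j) by [].
by apply/funext => s; rewrite mxE.
Qed.

(** The intervals of radius K 2^-n around a n meet pairwise, so the supremum of their left ends lies
    in all of them. *)
Lemma geometric_cauchy (a : nat -> R) (K : R) :
  (forall n k, `|a (n + k)%N - a n| <= K * 2^-1 ^+ n) ->
  exists l, forall n, `|l - a n| <= K * 2^-1 ^+ n.
Proof.
move=> aK; pose A := [set a n - K * 2^-1 ^+ n | n in [set: nat]].
have K0 n : 0 <= K * 2^-1 ^+ n by apply: le_trans (aK n 0%N); exact: normr_ge0.
have an m n : a m - K * 2^-1 ^+ m <= a n + K * 2^-1 ^+ n.
  have [mn|/ltnW nm] := leqP m n.
    have := aK m (n - m)%N; rewrite subnKC// ler_distlC => /andP[_ am].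
    by rewrite lerBlDr (le_trans am)// addrAC lerDl.
  have := aK n (m - n)%N; rewrite subnKC// ler_distl => /andP[_].
  by apply: le_trans; rewrite gerDl oppr_le0.
exists (sup A) => n; rewrite ler_distl; apply/andP; split.
  apply: ub_le_sup; last by exists n.
  by exists (a n + K * 2^-1 ^+ n) => _ [m _ <-].
apply: ge_sup => [|_ [m _ <-]//].
by exists (a 0%N - K * 2^-1 ^+ 0); exists 0%N.
Qed.

Lemma geometric_small (K e : R) : 0 < e -> exists n, K * 2^-1 ^+ n < e.
Proof.
move=> e0; have [n Kn] : exists n : nat, K / e < n%:R.
  exists (Num.Def.archi_bound `|K / e|).
  by rewrite (le_lt_trans (ler_norm _))// archi_boundP.
exists n; rewrite exprVn ltr_pdivrMr ?exprn_gt0//.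
rewrite mulrC -ltr_pdivrMr// (lt_le_trans Kn)// -natrX ler_nat ltnW//.
exact: ltn_expl.
Qed.

End ODE.

(** * Picard iteration on the unit interval *)

Section ODEexistence.
Context {R : realType}.

Let clamp01 (t : R) : R := Num.max 0 (Num.min 1 t).

Lemma clamp01_itv t : 0 <= clamp01 t <= 1.
Proof. by rewrite le_max lexx /= ge_max ler01 ge_min lexx. Qed.

Lemma clamp01_id t : 0 <= t <= 1 -> clamp01 t = t.
Proof. by move=> /andP[t0 t1]; rewrite /clamp01 min_r// max_r. Qed.

Lemma clamp01_continuous : continuous clamp01.
Proof.
move=> t.
have c1 : {for t, continuous ((cst 1 : R -> R^o) \min (id : R -> R^o))}.
  by apply: continuous_min; [exact: cst_continuous|exact: cvg_id].
exact: (continuous_max (@cst_continuous _ R^o 0 t) c1).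
Qed.

(** Compare through [Phi s (u t)]: one half uses continuity in time at a fixed state, the other the
    Lipschitz bound, which is uniform in time. *)
Lemma lipschitz_comp_continuous m (Phi : R -> 'rV[R]_m -> 'rV[R]_m) (K : R)
    (u : R -> 'rV[R]_m) :
  0 <= K -> (forall y, continuous (Phi ^~ y)) ->
  (forall t y y', `|Phi t y - Phi t y'| <= K * `|y - y'|) ->
  continuous u -> continuous (fun t => Phi t (u t)).
Proof.
move=> K0 Pc PL uc t; apply/cvgrPdist_le => e e0.
have e2 : 0 < e / 2 by rewrite divr_gt0.
have eK : 0 < e / 2 / (K + 1) by rewrite divr_gt0// ltr_wpDl.
have /cvgrPdist_le /(_ _ eK) H1 := uc t.
have /cvgrPdist_le /(_ _ e2) H2 := Pc (u t) t.
near=> s.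
apply: le_trans (ler_distD (Phi s (u t)) _ _) _; rewrite [leRHS]splitr lerD//.
  by near: s.
rewrite (le_trans (PL _ _ _))//.
rewrite (@le_trans _ _ (K * (e / 2 / (K + 1))))//.
  by rewrite ler_wpM2l//; near: s.
by rewrite mulrCA ger_pMr// ler_pdivrMr ?ltr_wpDl// mul1r lerDl.
Unshelve. all: by end_near. Qed.

(** Over unit time the integral operator of a field with Lipschitz constant 2^-1 contracts the
    uniform distance by 2^-1, so its iterates converge geometrically on the whole interval. *)
Theorem ode_exists m (Phi : R -> 'rV[R]_m -> 'rV[R]_m) (y0 : 'rV[R]_m) :
  (forall y, continuous (Phi ^~ y)) ->
  (forall t y y', `|Phi t y - Phi t y'| <= 2^-1 * `|y - y'|) ->
  exists2 y : R -> 'rV[R]_m, y 0 = y0 &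
    forall t : R, 0 <= t <= 1 -> is_derive t 1 y (Phi t (y t)).
Proof.
move=> Pc PL.
have half0 : 0 <= (2^-1 : R) by rewrite invr_ge0.
have Puc u : continuous u -> continuous (fun t => Phi t (u t)).
  exact: lipschitz_comp_continuous PL.
(* A primitive is chosen for all u at once; nothing is claimed for a discontinuous u, where it is 0
   by default. *)
have /choice[P HP] : forall u : R -> 'rV[R]_m, exists H : R -> 'rV[R]_m,
    continuous u -> H 0 = 0 /\
    forall t : R, 0 <= t <= 1 -> is_derive t 1 H (Phi t (u t)).
  move=> u; have [uc|nuc] := pselect (continuous u); last by exists (cst 0).
  by have [H H0 HD] := primitive_mx (Puc u uc); exists H.
(* Clamping time gives continuous iterates with bounds valid on all of R, although the primitive is
   controlled on [[0, 1]] only. *)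
pose T u t := y0 + P u (clamp01 t).
have Tc u : continuous u -> continuous (T u).
  move=> uc t; have [_ /(_ _ (clamp01_itv t)) [dP _]] := HP u uc.
  have cP : {for clamp01 t, continuous (P u)}.
    by apply/differentiable_continuous/derivable1_diffP.
  have cPt := continuous_comp (@clamp01_continuous t) cP.
  exact: (continuousD (@cst_continuous _ _ y0 t) cPt).
have Tcontr u v e : continuous u -> continuous v ->
    (forall t, `|u t - v t| <= e) -> forall t, `|T u t - T v t| <= 2^-1 * e.
  move=> uc vc uv t; have [Pu0 PuD] := HP u uc; have [Pv0 PvD] := HP v vc.
  have /andP[t0 t1] := clamp01_itv t.
  rewrite /T opprD addrACA subrr add0r.
  have D (s : R) : 0 <= s <= 1 ->
      is_derive s 1 (P u - P v) (Phi s (u s) - Phi s (v s)).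
    by move=> s01; apply: is_deriveB; [exact: PuD|exact: PvD].
  have := @mvt_ineq _ _ _ (P u - P v) _ (2^-1 * e) (clamp01 t) D _ (clamp01_itv t).
  rewrite !fctE Pu0 Pv0 subrr subr0.
  have e0 : 0 <= e by apply: le_trans (uv 0); exact: normr_ge0.
  move=> H; apply: le_trans (H _) _.
    by move=> s _; rewrite (le_trans (PL _ _ _))// ler_wpM2l.
  by rewrite ler_piMr// mulr_ge0.
pose u n := iter n T (cst y0).
have uc n : continuous (u n) by elim: n => [|n IH]; [exact: cst_continuous|exact: Tc].
have [C HC] : exists C, forall t, `|u 1%N t - u 0%N t| <= C.
  have cf := Puc _ (@cst_continuous R 'rV[R]_m y0).
  have [c _ Hc] := @EVT_max R (fun t => `|Phi t y0|) 0 1 ler01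
    (continuous_subspaceT (fun t => cvg_norm (cf t))).
  exists `|Phi c y0| => t; have [Pu0 PuD] := HP _ (@cst_continuous _ _ y0).
  have /andP[t0 t1] := clamp01_itv t.
  have := @mvt_ineq _ _ _ (P (cst y0)) _ `|Phi c y0| (clamp01 t) PuD _ (clamp01_itv t).
  rewrite Pu0 subr0 /u /= /T addrC addKr => H.
  apply: le_trans (H _) _; first by move=> s s01; apply: Hc; rewrite in_itv.
  by rewrite ler_piMr.
have uS n t : `|u n.+1 t - u n t| <= C * 2^-1 ^+ n.
  elim: n t => [|n IH] t; first by rewrite expr0 mulr1.
  by rewrite exprS mulrCA; exact: (Tcontr _ _ _ (uc n.+1) (uc n) IH t).
have C0 : 0 <= C by apply: le_trans (HC 0); exact: normr_ge0.
have uC n k t : `|u (n + k)%N t - u n t| <= 2 * C * 2^-1 ^+ n.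
  (* The bound by the partial geometric sum is the form that induction on k can carry. *)
  suff : `|u (n + k)%N t - u n t| <= 2 * C * (2^-1 ^+ n - 2^-1 ^+ (n + k)).
    move/le_trans; apply; rewrite ler_wpM2l ?mulr_ge0// gerDl oppr_le0.
    by rewrite exprn_ge0.
  elim: k => [|k IH]; first by rewrite addn0 !subrr normr0 mulr0.
  rewrite addnS; apply: le_trans (ler_distD (u (n + k)%N t) _ _) _.
  apply: le_trans (lerD (uS _ _) IH) _.
  rewrite exprS; set a := _ ^+ (n + k); set b := _ ^+ n.
  by rewrite le_eqVlt; apply/orP; left; apply/eqP; field.
have /choice[w Hw] : forall t, exists l : 'rV[R]_m,
    forall n, `|l - u n t| <= 2 * C * 2^-1 ^+ n.
  move=> t; have /choice[l Hl] : forall j : 'I_m, exists l : R,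
      forall n, `|l - u n t 0 j| <= 2 * C * 2^-1 ^+ n.
    move=> j; apply: geometric_cauchy => n k; apply: le_trans (uC n k t).
    by have := norm_entry_le (u (n + k)%N t - u n t) 0 j; rewrite !mxE.
  exists (\row_j l j) => n; apply: mx_norm_le.
    by rewrite mulr_ge0 ?exprn_ge0// mulr_ge0.
  by move=> i j; rewrite !mxE ord1; exact: Hl.
have wc : continuous w.
  move=> t; apply/cvgrPdist_le => e e0.
  have e3 : 0 < e / 3 by rewrite divr_gt0.
  have [n Hn] := geometric_small (2 * C) e3.
  have /cvgrPdist_le /(_ _ e3) H1 := uc n t.
  near=> s.
  have -> : w t - w s = (w t - u n t) + (u n t - u n s) + (u n s - w s).
    by rewrite !addrA !subrK.
  have -> : e = e / 3 + e / 3 + e / 3.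
    by field.
  rewrite (le_trans (ler_normD _ _))// lerD//.
    rewrite (le_trans (ler_normD _ _))// lerD//; last by near: s.
    by rewrite (le_trans (Hw _ n))// ltW.
  by rewrite distrC (le_trans (Hw _ n))// ltW.
have Tw t : T w t = w t.
  apply/eqP; rewrite -subr_eq0 -normr_le0; apply/ler_addgt0Pl => e e0.
  rewrite addr0; have [n Hn] := geometric_small (2 * C) e0.
  apply: le_trans (ltW Hn); apply: le_trans (ler_distD (u n.+1 t) _ _) _.
  have H1 := Tcontr w (u n) _ wc (uc n) (fun t => Hw t n) t.
  have H2 := Hw t n.+1; rewrite distrC in H2.
  apply: le_trans (lerD H1 H2) _.
  by rewrite exprS le_eqVlt; apply/orP; left; apply/eqP; field.
have [Pw0 PwD] := HP w wc.
(* The fixed point w is clamped in time and may lack a two-sided derivative at 0 and 1; the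
   unclamped primitive has one and agrees with w on the interval. *)
exists (fun t => y0 + P w t); first by rewrite Pw0 addr0.
move=> t t01; have <- : w t = y0 + P w t by rewrite -[LHS]Tw /T clamp01_id.
have := is_deriveD (is_derive_cst y0 t 1) (PwD t t01).
by rewrite add0r.
Unshelve. all: by end_near. Qed.

End ODEexistence.

(** * The Frobenius theorem *)

Section LocalBounds.
Context {R : realType}.

Lemma norm_mulmx_le p q r (A : 'M[R]_(p, q)) (B : 'M[R]_(q, r)) :
  `|A *m B| <= q%:R * `|A| * `|B|.
Proof.
apply: mx_norm_le; first by rewrite !mulr_ge0.
move=> i j; rewrite mxE (le_trans (ler_norm_sum _ _ _))//.
rewrite (@le_trans _ _ (\sum_(k < q) `|A| * `|B|))//.
  by apply: ler_sum => k _; rewrite normrM ler_pM ?norm_entry_le.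
by rewrite sumr_const card_ord -mulrA mulr_natl.
Qed.

Lemma near_norm_bounded n (W : normedModType R) (G : 'rV[R]_n -> W) q0 :
  {for q0, continuous G} -> \forall q \near q0, `|G q| <= `|G q0| + 1.
Proof.
move=> cG; have /cvgrPdist_le /(_ _ ltr01) := cG; apply: near_imp => q H.
rewrite -[G q](subrK (G q0)) addrC (le_trans (ler_normD _ _))// lerD2l.
by rewrite distrC.
Qed.

Lemma derive_locally_bounded n p q (G : 'rV[R]_n -> 'M[R]_(p, q)) q0 :
  smooth_near G q0 -> exists2 B : R, 0 <= B &
    \forall x \near q0, differentiable G x /\ forall u, `|'D_u G x| <= B * `|u|.
Proof.
move=> sG; exists (\sum_i (`|partial i G q0| + 1)).
  by apply: sumr_ge0 => i _; rewrite addr_ge0.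
have nb : \forall x \near q0, forall i, `|partial i G x| <= `|partial i G q0| + 1.
  apply: near_forall => i; apply: near_norm_bounded.
  exact: (smooth_near_continuous (smooth_near_partial i sG)).
apply: near_imp (near_and (smooth_near_near sG) nb) => x [/smooth_near_diff dG H].
split=> // u; rewrite derive_rV// mulr_suml (le_trans (ler_norm_sum _ _ _))//.
apply: ler_sum => i _; rewrite normrZ mulrC ler_pM//; exact: norm_entry_le.
Qed.

Lemma cball_convex (V : normedModType R) (q0 q q' : V) (e s : R) :
  0 <= s <= 1 -> `|q - q0| <= e -> `|q' - q0| <= e -> `|q + s *: (q' - q) - q0| <= e.
Proof.
move=> /andP[s0 s1] qe qe'.
have -> : q + s *: (q' - q) - q0 = (1 - s) *: (q - q0) + s *: (q' - q0).
  rewrite scalerBl scale1r -[RHS]addrA [- _ + _]addrC -scalerBr opprB addrA subrK.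
  by rewrite addrAC.
rewrite (le_trans (ler_normD _ _))// !normrZ !ger0_norm ?subr_ge0//.
have -> : e = (1 - s) * e + s * e by ring.
by rewrite lerD// ler_wpM2l// subr_ge0.
Qed.

Lemma lipschitz_of_derive n p q (G : 'rV[R]_n -> 'M[R]_(p, q)) q0 e B x x' :
  (forall y, `|y - q0| <= e -> differentiable G y /\
     forall u, `|'D_u G y| <= B * `|u|) ->
  `|x - q0| <= e -> `|x' - q0| <= e -> `|G x' - G x| <= B * `|x' - x|.
Proof.
move=> GB xe xe'.
have H (s : R) : 0 <= s <= 1 -> `|x + s *: (x' - x) - q0| <= e.
  by move=> s01; exact: cball_convex.
have D (s : R) : 0 <= s <= 1 -> is_derive s 1 (fun s : R => G (x + s *: (x' - x)))
    ('D_(x' - x) G (x + s *: (x' - x))).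
  by move=> s01; apply: is_derive_line; have [] := GB _ (H s s01).
have := @mvt_ineq _ _ _ _ _ (B * `|x' - x|) 1 D _ _.
have -> : x + 1 *: (x' - x) = x' by rewrite scale1r addrC subrK.
rewrite scale0r addr0 mulr1; apply; last by rewrite ler01 lexx.
by move=> s s01; have [_] := GB _ (H s s01); apply.
Qed.

(** The mean value inequality is applied to s |-> G (x + s D) - s ['D_D G x], whose derivative
    compares differentials at two points and so is controlled by the derivatives of the partials. *)
Lemma taylor1_bound n p q (G : 'rV[R]_n -> 'M[R]_(p, q)) q0 e (B : 'I_n -> R) x x' :
  (forall y, `|y - q0| <= e -> differentiable G y) ->
  (forall j y, `|y - q0| <= e -> differentiable (partial j G) y /\
     forall u, `|'D_u (partial j G) y| <= B j * `|u|) ->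
  (forall j, 0 <= B j) ->
  `|x - q0| <= e -> `|x' - q0| <= e ->
  `|G x' - G x - 'D_(x' - x) G x| <= (\sum_j B j) * `|x' - x| ^+ 2.
Proof.
move=> dG GB B0 xe xe'; set D := x' - x.
have H (s : R) : 0 <= s <= 1 -> `|x + s *: D - q0| <= e.
  by move=> s01; exact: cball_convex.
have D1 (s : R) : 0 <= s <= 1 ->
    is_derive s 1 ((fun s : R => G (x + s *: D)) - ( *:%R ^~ ('D_D G x)))
      ('D_D G (x + s *: D) - 'D_D G x).
  move=> s01; apply: is_deriveB.
    by apply: is_derive_line; apply: dG; exact: H.
  have i1 := is_diff_scalel s ('D_D G x).
  apply: DeriveDef; first by apply: diff_derivable; exact: ex_diff.
  rewrite deriveE; last exact: ex_diff.
  by rewrite diff_val scale1r.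
have := @mvt_ineq _ _ _ _ _ ((\sum_j B j) * `|D| ^+ 2) 1 D1 _ _.
rewrite !fctE !scale0r addr0 subr0 mulr1 !scale1r.
have -> : x + D = x' by rewrite /D addrC subrK.
rewrite addrAC; apply.
  move=> s s01; have /andP[s0 s1] := s01.
  rewrite (derive_rV _ (dG _ (H s s01))) (derive_rV _ (dG _ xe)) -sumrB mulr_suml.
  rewrite (le_trans (ler_norm_sum _ _ _))//; apply: ler_sum => j _.
  rewrite -scalerBr normrZ expr2 mulrCA ler_pM ?norm_entry_le//.
  rewrite (le_trans (lipschitz_of_derive (GB j) xe (H s s01)))//.
  rewrite addrAC subrr add0r normrZ ger0_norm// ler_wpM2l//.
  by rewrite ler_piMl.
by rewrite ler01 lexx.
Qed.

(** One constant K serves for all estimates on every small enough closed ball, so the radius can be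
    chosen after K. *)
Lemma local_bounds n p q (G : 'rV[R]_n -> 'M[R]_(p, q)) q0 :
  smooth_near G q0 -> exists2 K : R, 0 <= K &
    \forall e \near 0^'+, forall x x', `|x - q0| <= e -> `|x' - q0| <= e ->
    [/\ differentiable G x, `|G x| <= K,
      `|G x' - G x| <= K * `|x' - x|,
      forall u, `|'D_u G x| <= K * `|u| &
      `|G x' - G x - 'D_(x' - x) G x| <= K * `|x' - x| ^+ 2].
Proof.
move=> sG; have [B1 B10 H1] := derive_locally_bounded sG.
have /choice[B HB] : forall j, exists B : R, 0 <= B /\
    \forall x \near q0, differentiable (partial j G) x /\
      forall u, `|'D_u (partial j G) x| <= B * `|u|.
  by move=> j; have [B B0 HB] := derive_locally_bounded (smooth_near_partial j sG); exists B.
have B2 := near_forall (fun j => (HB j).2).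
have nb := near_norm_bounded (smooth_near_continuous sG).
have SB0 : 0 <= \sum_j B j by apply: sumr_ge0 => j _; have [] := HB j.
exists (`|G q0| + 1 + B1 + \sum_j B j); first by rewrite !addr_ge0.
have := near_and nb (near_and H1 B2) => /nbhs_ballP[r /= r0 Hr].
near=> e => x x' xe xe'.
have in_r y : `|y - q0| <= e -> ball q0 r y.
  rewrite -ball_normE /ball_ /= distrC => /le_lt_trans; apply.
  by near: e; exact: nbhs_right_lt.
have K1 (a : R) : 0 <= a -> forall b, b <= B1 * a -> b <= (`|G q0| + 1 + B1 + \sum_j B j) * a.
  move=> a0 b /le_trans; apply; rewrite ler_wpM2r//.
  by have := normr_ge0 (G q0); lra.
have [Gx [[dGx DGx] _]] := Hr _ (in_r _ xe).
split => //.
- by rewrite (le_trans Gx)// -addrA lerDl addr_ge0.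
- exact: (K1 _ (normr_ge0 _) _
    (lipschitz_of_derive (fun y ye => (Hr _ (in_r _ ye)).2.1) xe xe')).
- by move=> u; apply: K1 => //; exact: DGx.
- apply: le_trans (@taylor1_bound _ _ _ G q0 e B x x' _ _ _ xe xe') _.
  + by move=> y /in_r /Hr[_ [[]]].
  + by move=> j y /in_r /Hr[_ [_]]; apply.
  + by move=> j; have [] := HB j.
  + by rewrite ler_wpM2r// lerDr !addr_ge0.
Unshelve. all: by end_near. Qed.

End LocalBounds.

(** * Projection onto a cube *)

Section ClampBox.
Context {R : realType}.

Lemma clamp_scalar_in (a e x : R) : 0 <= e ->
  `|Num.max (a - e) (Num.min (a + e) x) - a| <= e.
Proof.
move=> e0; rewrite ler_norml; have [h1|h1] := leP (a + e) x;
  [have [h2|h2] := leP (a - e) (a + e)|have [h2|h2] := leP (a - e) x]; lra.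
Qed.

Lemma clamp_scalar_id (a e x : R) : `|x - a| <= e ->
  Num.max (a - e) (Num.min (a + e) x) = x.
Proof.
rewrite ler_norml => /andP[h1 h2]; rewrite min_r; last by lra.
by rewrite max_r//; lra.
Qed.

Lemma clamp_scalar_lip (a e x y : R) :
  `|Num.max (a - e) (Num.min (a + e) x) - Num.max (a - e) (Num.min (a + e) y)| <= `|x - y|.
Proof.
have [h1|h1] := leP (a + e) x; have [h2|h2] := leP (a + e) y;
  repeat match goal with |- context [Num.max ?u ?v] => have [?|?] := leP u v end;
  rewrite ler_norml; have [h3|h3] := ler0P (x - y); lra.
Qed.

(** The projection onto the closed sup-norm ball of radius e. It is 1-Lipschitz, so composing with
    it extends a local Lipschitz bound to the whole space, as [ode_exists] requires. *)
Definition clamp_box n (q0 : 'rV[R]_n) (e : R) (q : 'rV[R]_n) : 'rV[R]_n :=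
  \row_j Num.max (q0 0 j - e) (Num.min (q0 0 j + e) (q 0 j)).

Lemma clamp_box_in n (q0 : 'rV[R]_n) e q : 0 <= e -> `|clamp_box q0 e q - q0| <= e.
Proof.
by move=> e0; apply: mx_norm_le => // i j; rewrite !mxE ord1 clamp_scalar_in.
Qed.

Lemma clamp_box_id n (q0 : 'rV[R]_n) e q : `|q - q0| <= e -> clamp_box q0 e q = q.
Proof.
move=> qe; apply/rowP => j; rewrite mxE clamp_scalar_id//.
by apply: le_trans qe; have := norm_entry_le (q - q0) 0 j; rewrite !mxE.
Qed.

Lemma clamp_box_lip n (q0 : 'rV[R]_n) e q q' :
  `|clamp_box q0 e q - clamp_box q0 e q'| <= `|q - q'|.
Proof.
apply: mx_norm_le => // i j; rewrite !mxE (le_trans (clamp_scalar_lip _ _ _ _))//.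
by have := norm_entry_le (q - q') 0 j; rewrite !mxE.
Qed.

Lemma norm_row_mx_le p q (a : 'rV[R]_p) (b : 'rV[R]_q) e :
  `|a| <= e -> `|b| <= e -> `|row_mx a b| <= e.
Proof.
move=> ae be; apply: mx_norm_le; first exact: le_trans ae.
move=> i j; case: (split_ordP j) => k ->; rewrite ?row_mxEl ?row_mxEr.
  exact: le_trans (norm_entry_le _ _ _) ae.
exact: le_trans (norm_entry_le _ _ _) be.
Qed.

Lemma row_mxB p q (a a' : 'rV[R]_p) (b b' : 'rV[R]_q) :
  row_mx a b - row_mx a' b' = row_mx (a - a') (b - b').
Proof. by rewrite opp_row_mx add_row_mx. Qed.

Lemma lipschitz_continuous (V W : normedModType R) (f : V -> W) (K : R) :
  (forall x y, `|f x - f y| <= K * `|x - y|) -> continuous f.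
Proof.
move=> fK x; apply/cvgrPdist_le => e e0.
have K1 : 0 < `|K| + 1 by rewrite ltr_wpDl.
near=> y; rewrite (le_trans (fK x y))//.
rewrite (@le_trans _ _ ((`|K| + 1) * `|x - y|))//.
  by rewrite ler_wpM2r// (le_trans (ler_norm K))// lerDl.
rewrite -ler_pdivlMl//; near: y.
have idc : id y @[y --> x] --> x by exact: cvg_id.
move/cvgrPdist_le : idc; apply.
by rewrite mulrC divr_gt0.
Unshelve. all: by end_near. Qed.

End ClampBox.

(** Here x, h, z, D are the norms of the ray direction, of its increment, of the error and of the
    displacement. Since N (N + 1) rho is at most 1/20, substituting the bound on D leaves z with
    total coefficient 1/10 + 1/5 + 1/20 <= 1/2, and the rest is quadratic in h. *)
Lemma error_bound (R : realType) (N rho x h z D : R) :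
  1 <= N -> 0 < rho <= 1 -> N * (N + 1) * rho <= 20^-1 ->
  0 <= x <= rho -> 0 <= h <= 2 * rho -> 0 <= z -> 0 <= D <= 2 ->
  D <= z + (N + 1) * h ->
  N * h * D + N * x * D ^+ 2 + N * x * z <=
  2^-1 * z + 2 * N * (N + 1) ^+ 2 * h ^+ 2.
Proof.
move=> N1 /andP[r0 r1] Nr /andP[x0 xr] /andP[h0 hr] z0 /andP[D0 D2] Dz.
have N0 : 0 <= N by exact: le_trans ler01 N1.
have L0 : 0 <= N + 1 by lra.
have Nrho : N * rho <= 20^-1.
  by apply: le_trans Nr; rewrite ler_wpM2r ?(ltW r0)// ler_peMr//; lra.
have zrho : rho * z <= z by rewrite ler_piMl.
have Nx : N * x <= N * rho by rewrite ler_wpM2l.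
have Nxz : N * x * z <= 20^-1 * z by rewrite ler_wpM2r// (le_trans Nx).
have Nh : N * h <= 10^-1.
  by rewrite (@le_trans _ _ (N * (2 * rho)))// ?ler_wpM2l//; lra.
have T1 : N * h * D <= 10^-1 * z + N * (N + 1) * h ^+ 2.
  apply: le_trans (ler_wpM2l _ Dz) _; first by rewrite mulr_ge0.
  have : N * h * z <= 10^-1 * z by rewrite ler_wpM2r.
  move=> H; have -> : N * h * (z + (N + 1) * h) = N * h * z + N * (N + 1) * h ^+ 2.
    by ring.
  by lra.
have T2 : N * x * D ^+ 2 <= 5^-1 * z + N * (N + 1) ^+ 2 * h ^+ 2.
  have D2z : D ^+ 2 <= 2 * z + (N + 1) * h * (z + (N + 1) * h).
    rewrite expr2 (le_trans (ler_wpM2l D0 Dz))// mulrDr lerD ?ler_wpM2r//.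
    by rewrite mulrC ler_wpM2l// mulr_ge0.
  apply: le_trans (ler_wpM2l _ D2z) _; first by rewrite mulr_ge0.
  have A1 : N * x * (2 * z) <= 10^-1 * z.
    have -> : N * x * (2 * z) = 2 * (N * x * z) by ring.
    by lra.
  have A2 : N * x * ((N + 1) * h * z) <= 10^-1 * z.
    have -> : N * x * ((N + 1) * h * z) = (N * (N + 1) * x) * h * z by ring.
    rewrite ler_wpM2r//.
    rewrite (@le_trans _ _ (20^-1 * 2))//; last by lra.
    apply: ler_pM => //; first by rewrite !mulr_ge0.
      by apply: le_trans Nr; rewrite ler_wpM2l// mulr_ge0.
    by lra.
  have A3 : N * x * ((N + 1) * h * ((N + 1) * h)) <= N * (N + 1) ^+ 2 * h ^+ 2.
    have -> : N * x * ((N + 1) * h * ((N + 1) * h)) = x * (N * (N + 1) ^+ 2 * h ^+ 2) by ring.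
    by rewrite ler_piMl ?mulr_ge0 ?exprn_ge0//; lra.
  have -> : N * x * (2 * z + (N + 1) * h * (z + (N + 1) * h)) =
    N * x * (2 * z) + N * x * ((N + 1) * h * z) + N * x * ((N + 1) * h * ((N + 1) * h)).
    by ring.
  by lra.
have T3 : N * (N + 1) * h ^+ 2 <= N * (N + 1) ^+ 2 * h ^+ 2.
  by rewrite ler_wpM2r ?exprn_ge0// ler_wpM2l// expr2 ler_peMr//; lra.
by lra.
Qed.

(** The left side is the derivative of the prediction error. The hypothesis, which is the
    integrability condition, trades the derivative of F along the ray for the one along the
    increment; this completes a first-order Taylor remainder of F. *)
Lemma ray_error_algebra (R : realType) (m d : nat) (x h : 'rV[R]_d)
    (A A' Dz Dx Dh : 'M[R]_(d, m)) t : h *m Dx = x *m Dh ->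
  (x + h) *m A' - x *m A - (h *m A + t *: (h *m Dx)) =
  h *m (A' - A) + x *m (A' - A - (Dz + t *: Dh)) + x *m Dz.
Proof.
move=> ->; rewrite mulmxDl !mulmxBr mulmxDr -scalemxAr.
move: (x *m A') (x *m A) (h *m A') (h *m A) (x *m Dh) (x *m Dz) => a b c f g u.
by apply/rowP => k; rewrite !mxE; ring.
Qed.

(** * Total differential equations solved along rays *)

Section FrobeniusCore.
Context {R : realType} {m d : nat}.
Variables (F : 'rV[R]_(m + d) -> 'M[R]_(d, m)) (s0 : 'rV[R]_m) (r0 : 'rV[R]_d).
Variables (N e rho : R).

Let q0 := row_mx s0 r0.

(** The direction tangent over v to the graph of a solution of ds = dr F(s, r). Symmetry in v, w of
    [w *m 'D_(lift_dir q v) F q] is the equality of the mixed second derivatives of a solution. *)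
Definition lift_dir q (v : 'rV[R]_d) : 'rV[R]_(m + d) := row_mx (v *m F q) v.

Hypothesis e01 : 0 < e <= 1.
Hypothesis rho01 : 0 < rho <= 1.
Hypothesis rhoe : rho <= e.
Hypothesis N1 : 1 <= N.
Hypothesis Nrhoe : N * rho <= e.
Hypothesis Nrho : N * (N + 1) * rho <= 20^-1.
Hypothesis F_bounds : forall x x', `|x - q0| <= e -> `|x' - q0| <= e ->
  [/\ differentiable F x,
      forall w : 'rV[R]_d, `|w *m F x| <= N * `|w|,
      forall w : 'rV[R]_d, `|w *m (F x' - F x)| <= N * `|w| * `|x' - x|,
      forall (w : 'rV[R]_d) u, `|w *m 'D_u F x| <= N * `|w| * `|u| &
      forall w : 'rV[R]_d, `|w *m (F x' - F x - 'D_(x' - x) F x)| <= N * `|w| * `|x' - x| ^+ 2].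
Hypothesis F_integrable : forall q, `|q - q0| <= e -> forall v w,
  w *m 'D_(lift_dir q v) F q = v *m 'D_(lift_dir q w) F q.

Let path x (y : R -> 'rV[R]_m) (t : R) := row_mx (y t) (r0 + t *: x).

(** The equation is solved for F clamped to the cube, whose Lipschitz constant N rho along the ray
    is at most 2^-1. The speed bound N rho <= e keeps the solution in the cube, where the clamping
    is invisible. *)
Lemma ray_solution x : `|x| <= rho -> exists y : R -> 'rV[R]_m, y 0 = s0 /\
  forall t : R, 0 <= t <= 1 -> `|path x y t - q0| <= e /\
    is_derive t 1 y (x *m F (path x y t)).
Proof.
move=> xr; have [e0 _] := andP e01; have [rho0 _] := andP rho01.
have N0 : 0 <= N by exact: le_trans ler01 N1.
have cl q : `|clamp_box q0 e q - q0| <= e by apply: clamp_box_in; exact: ltW.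
pose Phi (t : R) (y : 'rV[R]_m) := x *m F (clamp_box q0 e (row_mx y (r0 + t *: x))).
have PL q q' : `|x *m F (clamp_box q0 e q) - x *m F (clamp_box q0 e q')| <=
    N * `|x| * `|q - q'|.
  rewrite -mulmxBr; have [_ _ H _ _] := F_bounds (cl q') (cl q).
  apply: le_trans (H x) _; rewrite ler_wpM2l//; last exact: clamp_box_lip.
  by rewrite mulr_ge0.
have [||y y0 yD] := @ode_exists R m Phi s0.
- move=> y; apply: (@lipschitz_continuous _ _ _ _ (N * `|x| * `|x|)) => t t'.
  rewrite (le_trans (PL _ _))// -[leRHS]mulrA ler_wpM2l ?mulr_ge0//.
  rewrite row_mxB subrr opprD addrACA subrr add0r -scalerBl.
  by rewrite norm_row_mx_le// ?normr0 ?mulr_ge0// normrZ mulrC.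
- move=> t y y'; rewrite (le_trans (PL _ _))//.
  rewrite row_mxB subrr; apply: ler_pM => //; first by rewrite mulr_ge0.
    rewrite (@le_trans _ _ (N * rho))//; first by rewrite ler_wpM2l.
    apply: le_trans (@le_trans _ _ _ _ _ _ Nrho) _; last by rewrite lef_pV2 ?posrE// ler_nat.
    by rewrite mulrAC ler_peMr ?mulr_ge0 ?(ltW rho0)//; lra.
  by rewrite norm_row_mx_le// normr0.
exists y; split => // t t01; have [t0 t1] := andP t01.
have Hp : `|path x y t - q0| <= e.
  rewrite row_mxB norm_row_mx_le//.
    rewrite -y0; apply: le_trans (@mvt_ineq R _ _ y _ (N * `|x|) t yD _ t01) _.
      move=> s s01; have [_ H _ _ _] := F_bounds (cl (row_mx (y s) (r0 + s *: x)))
        (cl (row_mx (y s) (r0 + s *: x))).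
      exact: H.
    rewrite (@le_trans _ _ (N * rho))//.
    rewrite -mulrA ler_wpM2l ?N0//.
    by rewrite (le_trans _ xr)// ler_piMr.
  rewrite addrAC subrr add0r normrZ ger0_norm//.
  by rewrite (le_trans _ rhoe)// (le_trans _ xr)// ler_piMl.
split=> //; have := yD t t01; rewrite /Phi clamp_box_id//.
Qed.

Lemma is_derive_row_mx p q (a : R -> 'rV[R]_p) (b : R -> 'rV[R]_q) (t : R) da db :
  is_derive t 1 a da -> is_derive t 1 b db ->
  is_derive t 1 (fun s => row_mx (a s) (b s)) (row_mx da db).
Proof.
move=> /is_derive_mx Ha /is_derive_mx Hb; apply/is_derive_mx => i j.
case: (split_ordP j) => k ->.
  rewrite row_mxEl; suff -> : (fun s => row_mx (a s) (b s) i (lshift q k)) =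
    (fun s => a s i k) by exact: Ha.
  by apply/funext => s; rewrite row_mxEl.
rewrite row_mxEr; suff -> : (fun s => row_mx (a s) (b s) i (rshift p k)) =
  (fun s => b s i k) by exact: Hb.
by apply/funext => s; rewrite row_mxEr.
Qed.

(* The error of the linear prediction of the endpoint solution satisfies a     *)
(* differential inequality thanks to the integrability condition.              *)
Lemma ray_error x h (y y' : R -> 'rV[R]_m) (t : R) :
  0 <= t <= 1 ->
  `|x| <= rho -> `|h| <= 2 * rho ->
  `|path x y t - q0| <= e -> `|path (x + h) y' t - q0| <= e ->
  is_derive t 1 y (x *m F (path x y t)) ->
  is_derive t 1 y' ((x + h) *m F (path (x + h) y' t)) ->
  let z s := y' s - y s - s *: (h *m F (path x y s)) in
  exists2 dz, is_derive t 1 z dz &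
    `|dz| <= 2^-1 * `|z t| + 2 * N * (N + 1) ^+ 2 * `|h| ^+ 2.
Proof.
move=> t01 xr hr qe qe' yD y'D z; have [t0 t1] := andP t01.
have N0 : 0 <= N by exact: le_trans ler01 N1.
set q := path x y t in qe yD *; set q' := path (x + h) y' t in qe' y'D *.
have [dF b1 b2 b3 b4] := F_bounds qe qe'.
have lD (v : 'rV[R]_d) : is_derive t 1 (fun s : R => r0 + s *: v) v.
  have [dl] := is_diffD (is_diff_cst r0 t) (is_diff_scalel t v).
  rewrite add0r => dE; apply: DeriveDef; first exact: diff_derivable.
  by rewrite deriveE// dE scale1r.
have qD : is_derive t 1 (path x y) (lift_dir q x) by exact: is_derive_row_mx.
have dq : differentiable (path x y) t by have [/derivable1_diffP] := qD.
have dFq : differentiable (F \o path x y) t by exact: differentiable_comp.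
have FqD : is_derive t 1 (fun s => h *m F (path x y s)) (h *m 'D_(lift_dir q x) F q).
  apply: DeriveDef.
    exact/diff_derivable/(differentiable_mulmx (differentiable_cst h t) dFq).
  apply: etrans (derive_mulmxl h _ dFq) _; congr (h *m _).
  by apply: etrans (derive_comp _ dq dF) _; have [_ ->] := qD.
have tFD : is_derive t 1 (fun s => s *: (h *m F (path x y s)))
    (h *m F q + t *: (h *m 'D_(lift_dir q x) F q)).
  apply/is_derive_mx => i j.
  have Dij := (is_derive_mx _ _ _).1 FqD i j.
  have := is_deriveM (is_derive_id t (1 : R)) Dij.
  move=> Dm; have -> : (fun s => (s *: (h *m F (path x y s))) i j) =
      id * (fun s => (h *m F (path x y s)) i j) by apply/funext => s; rewrite mxE.
  apply: is_derive_eq Dm _; rewrite [RHS]mxE [X in _ = _ + X]mxE addrC.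
  by congr (_ + _); exact: mulr1.
eexists; first exact: (is_deriveB (is_deriveB y'D yD) tFD).
(* The displacement is the error z plus t times the lift of h; by linearity this splits the
   derivative of F along it. *)
have Dz : q' - q = row_mx (z t) 0 + t *: lift_dir q h.
  rewrite /q' /q /path row_mxB /lift_dir scale_row_mx add_row_mx /z subrK; congr row_mx.
  by rewrite opprD addrACA subrr !add0r scalerDr addrAC subrr add0r.
set dz := (X in `|X|).
have -> : dz = h *m (F q' - F q) + x *m (F q' - F q - 'D_(q' - q) F q) +
    x *m 'D_(row_mx (z t) 0) F q.
  rewrite Dz (deriveDdir _ _ dF) (deriveZdir _ _ dF); apply: ray_error_algebra.
  exact: F_integrable.
have zz : `|row_mx (z t) (0 : 'rV[R]_d)| <= `|z t| by rewrite norm_row_mx_le// normr0.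
have Nx : N * `|x| <= N * rho by rewrite ler_wpM2l.
have Lh : `|lift_dir q h| <= (N + 1) * `|h|.
  by rewrite norm_row_mx_le ?(le_trans (b1 h))// ?ler_wpM2r// ?ler_peMl//; lra.
have D1 : `|q' - q| <= `|z t| + (N + 1) * `|h|.
  rewrite Dz (le_trans (ler_normD _ _))// lerD// normrZ ger0_norm//.
  by rewrite (le_trans _ Lh)// ler_piMl.
have D2 : `|q' - q| <= 2.
  rewrite (le_trans (ler_distD q0 _ _))// [`|q0 - q|]distrC.
  by have [_ e1] := andP e01; lra.
have P1 : `|h *m (F q' - F q)| <= N * `|h| * `|q' - q| by exact: b2.
have P2 : `|x *m (F q' - F q - 'D_(q' - q) F q)| <= N * `|x| * `|q' - q| ^+ 2 by exact: b4.
have P3 : `|x *m 'D_(row_mx (z t) 0) F q| <= N * `|x| * `|z t|.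
  by rewrite (le_trans (b3 _ _))// ler_wpM2l// mulr_ge0.
apply: le_trans (ler_normD _ _) _; apply: le_trans (lerD (ler_normD _ _) (lexx _)) _.
apply: le_trans (lerD (lerD P1 P2) P3) _.
apply: (error_bound N1 rho01 Nrho) => //; rewrite ?normr_ge0 //= ?D2 //.
Qed.

(** At the time c where |z| is largest, the differential inequality integrated over at most unit
    time gives |z c| <= |z c| / 2 + B, hence |z| <= 2 B throughout. *)
Lemma ray_increment x h (y y' : R -> 'rV[R]_m) :
  `|x| <= rho -> `|x + h| <= rho -> y 0 = s0 -> y' 0 = s0 ->
  (forall t : R, 0 <= t <= 1 -> `|path x y t - q0| <= e /\
    is_derive t 1 y (x *m F (path x y t))) ->
  (forall t : R, 0 <= t <= 1 -> `|path (x + h) y' t - q0| <= e /\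
    is_derive t 1 y' ((x + h) *m F (path (x + h) y' t))) ->
  `|y' 1 - y 1 - h *m F (path x y 1)| <= 4 * N * (N + 1) ^+ 2 * `|h| ^+ 2.
Proof.
move=> xr xhr y0 y'0 Hy Hy'.
have hr : `|h| <= 2 * rho.
  have -> : h = (x + h) - x by rewrite addrC addKr.
  by rewrite (le_trans (ler_normB _ _))// mulr_natl mulr2n lerD.
pose z s := y' s - y s - s *: (h *m F (path x y s)).
have Hz (t : R) : 0 <= t <= 1 -> exists2 dz, is_derive t 1 z dz &
    `|dz| <= 2^-1 * `|z t| + 2 * N * (N + 1) ^+ 2 * `|h| ^+ 2.
  move=> t01; have [? ?] := Hy t t01; have [? ?] := Hy' t t01.
  exact: ray_error.
have /choice[dz Hdz] : forall t : R, exists dz, 0 <= t <= 1 ->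
    is_derive t 1 z dz /\ `|dz| <= 2^-1 * `|z t| + 2 * N * (N + 1) ^+ 2 * `|h| ^+ 2.
  move=> t; have [/Hz[dz ? ?]|nt] := boolP (0 <= t <= 1); first by exists dz.
  by exists 0.
have zc : {within `[0, 1], continuous z}.
  apply: derivable_within_continuous => t; rewrite in_itv /= => t01.
  by have [[]] := Hdz t t01.
have [c c01 Hc] := @EVT_max R (fun t => `|z t|) 0 1 ler01 (fun t => cvg_norm (zc t)).
rewrite in_itv /= in c01.
set B := 2 * N * (N + 1) ^+ 2 * `|h| ^+ 2 in Hz Hdz.
have z0 : z 0 = 0 by rewrite /z y0 y'0 subrr scale0r subr0.
have bnd (s : R) : 0 <= s <= 1 -> `|dz s| <= 2^-1 * `|z c| + B.
  move=> s01; have [_ H] := Hdz s s01; apply: le_trans H _; rewrite lerD2r.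
  by rewrite ler_wpM2l ?invr_ge0// Hc// in_itv.
have zD (s : R) : 0 <= s <= 1 -> is_derive s 1 z (dz s) by move=> s01; have [] := Hdz s s01.
have := mvt_ineq zD bnd c01; rewrite z0 subr0 => zcB.
have B0 : 0 <= 2^-1 * `|z c| + B.
  by apply: le_trans (bnd 0 _); rewrite ?normr_ge0 ?lexx ?ler01.
have zcle : `|z c| <= 2^-1 * `|z c| + B.
  by have /andP[_ c1] := c01; rewrite (le_trans zcB)// ler_piMr.
have z1 : `|z 1| <= `|z c| by apply: Hc; rewrite in_itv /= ler01 lexx.
have -> : 4 * N * (N + 1) ^+ 2 * `|h| ^+ 2 = 2 * B by rewrite /B; ring.
by move: z1; rewrite /z scale1r => z1; lra.
Qed.

Lemma frobenius_core : exists g : 'rV[R]_d -> 'rV[R]_m, g r0 = s0 /\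
  forall r, `|r - r0| < rho -> [/\ `|row_mx (g r) r - q0| <= e,
    differentiable g r &
    forall v, 'D_v g r = v *m F (row_mx (g r) r)].
Proof.
have N0 : 0 <= N by exact: le_trans ler01 N1.
have /choice[Y HY] : forall x, exists y : R -> 'rV[R]_m, `|x| <= rho -> y 0 = s0 /\
  forall t : R, 0 <= t <= 1 -> `|path x y t - q0| <= e /\
    is_derive t 1 y (x *m F (path x y t)).
  move=> x; have [/ray_solution[y ?]|_] := boolP (`|x| <= rho); first by exists y.
  by exists (cst 0).
have pathE r : path (r - r0) (Y (r - r0)) 1 = row_mx (Y (r - r0) 1) r.
  by rewrite /path scale1r [r0 + _]addrC subrK.
exists (fun r => Y (r - r0) 1); split.
  (* The ray in direction 0 has zero velocity, so its endpoint is s0. *)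
  rewrite subrr; have [|Y0 YD] := HY 0.
    by rewrite normr0; have /andP[/ltW] := rho01.
  rewrite -[RHS]Y0; apply/eqP; rewrite -subr_eq0 -normr_le0.
  have D (t : R) : 0 <= t <= 1 -> is_derive t 1 (Y 0) 0.
    by move=> /YD[_]; rewrite mul0mx.
  have := @mvt_ineq R _ _ (Y 0) _ 0 1 D _ _.
  by rewrite mul0r; apply; rewrite ?ler01 ?lexx// => s _; rewrite normr0.
move=> r rr; have [|Y0 YD] := HY (r - r0); first exact: ltW.
have [|qe _] := YD 1; first by rewrite ler01 lexx.
rewrite pathE in qe.
(* The candidate differential is right multiplication by [M]; the quadratic bound of [ray_increment]
   is below a |h| once |h| is less than a over the constant plus 1. *)
set M := F (row_mx (Y (r - r0) 1) r).
have [|dg gE] := @diff_eps R _ _ (fun r => Y (r - r0) 1) r (mulmxr M)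
  (@linear_rV_continuous _ _ _ (mulmxr M)).
  move=> a a0.
  have P0 : 0 < 4 * N * (N + 1) ^+ 2 + 1 by rewrite ltr_wpDl// mulr_ge0 ?exprn_ge0 ?addr_ge0// mulr_ge0.
  have n1 : \forall h \near (0 : 'rV[R]_d), `|h| < rho - `|r - r0|.
    by apply: nbhs0_lt; rewrite subr_gt0.
  have n2 : \forall h \near (0 : 'rV[R]_d), `|h| < a / (4 * N * (N + 1) ^+ 2 + 1).
    by apply: nbhs0_lt; rewrite divr_gt0.
  apply: near_imp (near_and n1 n2) => h [h1 h2].
  have hx : h + r - r0 = (r - r0) + h by rewrite -addrA addrC.
  have xh : `|r - r0 + h| <= rho.
    by rewrite (le_trans (ler_normD _ _))// -lerBrDl ltW.
  have [Y0' YD'] := HY _ xh.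
  have := ray_increment (ltW rr) xh Y0 Y0' YD YD'.
  rewrite pathE hx /= => H; apply: le_trans H _.
  rewrite [`|h| ^+ 2]expr2 mulrA ler_wpM2r//.
  rewrite (@le_trans _ _ ((4 * N * (N + 1) ^+ 2 + 1) * `|h|))//.
    by rewrite ler_wpM2r// lerDl.
  by rewrite -ler_pdivlMl// mulrC ltW.
split => // v; rewrite deriveE// gE.
by [].
Qed.

End FrobeniusCore.

(** Bootstrapping: the equation writes the partial derivatives of g in terms of F and g, so they are
    as regular as g, and g gains one class. *)
Lemma total_differential_smooth (R : realType) m d
    (F : 'rV[R]_(m + d) -> 'M[R]_(d, m)) (g : 'rV[R]_d -> 'rV[R]_m)
    (U : set 'rV[R]_d) (V : set 'rV[R]_(m + d)) :
  open U -> open V -> (forall r, U r -> V (row_mx (g r) r)) -> smooth_on V F ->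
  (forall r, U r -> differentiable g r) ->
  (forall r, U r -> forall v, 'D_v g r = v *m F (row_mx (g r) r)) ->
  smooth_on U g.
Proof.
move=> oU oV UV sF dg gE; elim=> [|k IH].
  by move=> r /set_mem Ur; apply/differentiable_continuous/dg.
split=> // i.
have cgr : Ck_on k U (fun r => row_mx (g r) r).
  apply/Ck_on_mxP => // a b; case: (split_ordP b) => l ->.
    apply: Ck_on_eq oU _ ((Ck_on_mxP _ _ oU).1 IH a l) => r _.
    by rewrite row_mxEl.
  apply: Ck_on_eq oU _ (Ck_on_coord k U l) => r _.
  by rewrite row_mxEr ord1.
have cF a b : Ck_on k U (fun r => F (row_mx (g r) r) a b).
  apply: (@Ck_on_comp R d (m + d) k U V _ (fun q => F q a b) oU UV cgr).
  exact: ((Ck_on_mxP _ _ oV).1 (sF k)).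
apply: (@Ck_on_eq _ _ _ _ _ (fun r => row i (F (row_mx (g r) r)))) => //.
  by move=> r Ur; rewrite /partial gE// rowE.
apply/Ck_on_mxP => // a b; apply: Ck_on_eq oU _ (cF i b) => r _.
by rewrite mxE.
Qed.

Theorem frobenius (R : realType) m d (F : 'rV[R]_(m + d) -> 'M[R]_(d, m))
    (s0 : 'rV[R]_m) (r0 : 'rV[R]_d) :
  smooth_near F (row_mx s0 r0) ->
  (\forall q \near row_mx s0 r0, forall v w,
    w *m 'D_(lift_dir F q v) F q = v *m 'D_(lift_dir F q w) F q) ->
  exists g : 'rV[R]_d -> 'rV[R]_m, [/\ g r0 = s0, smooth_near g r0 &
    \forall r \near r0, forall v, 'D_v g r = v *m F (row_mx (g r) r)].
Proof.
set q0 := row_mx s0 r0 => sF Fint.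
have [K K0 nb] := local_bounds sF.
have [V [oV Vq0 HV]] := near_open (near_and (smooth_near_near sF) Fint).
have sFV : smooth_on V F by apply: smooth_near_on => q /HV[].
have /nbhs_ballP[b /= b0 Hb] : nbhs q0 V by exact: open_nbhs_nbhs.
have [e [e0 e1 He Hbe]] : exists e, [/\ 0 < e, e <= 1,
    (forall x x', `|x - q0| <= e -> `|x' - q0| <= e ->
    [/\ differentiable F x, `|F x| <= K,
      `|F x' - F x| <= K * `|x' - x|,
      forall u, `|'D_u F x| <= K * `|u| &
      `|F x' - F x - 'D_(x' - x) F x| <= K * `|x' - x| ^+ 2]) &
    forall x, `|x - q0| <= e -> V x].
  have [e [[[e0 e1] eb] He]] : exists e, ((0 < e /\ e < 1) /\ e < b) /\
      (forall x x', `|x - q0| <= e -> `|x' - q0| <= e ->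
      [/\ differentiable F x, `|F x| <= K,
        `|F x' - F x| <= K * `|x' - x|,
        forall u, `|'D_u F x| <= K * `|u| &
        `|F x' - F x - 'D_(x' - x) F x| <= K * `|x' - x| ^+ 2]).
    apply: (@filter_ex _ (0 : R)^'+).
    apply: filterI nb; apply: filterI; last exact: nbhs_right_lt.
    by apply: filterI; [exact: nbhs_right_gt|exact: nbhs_right_lt].
  exists e; split=> //; first exact: ltW.
  move=> x xe; apply: Hb; rewrite -ball_normE /ball_ /= distrC.
  exact: le_lt_trans eb.
(* The factor d comes from the norm of a matrix product; adding 1 ensures 1 <= N. *)
pose N : R := d%:R * K + 1.
have N1 : 1 <= N by rewrite lerDr mulr_ge0.
have N0 : 0 < N by exact: lt_le_trans ltr01 N1.
have L0 : 0 < N + 1 by rewrite addr_gt0.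
(* This radius makes N (N + 1) rho equal to e / 20, from which all the smallness conditions of the
   ray argument follow. *)
pose rho := e / (20 * N * (N + 1)).
have den0 : 0 < 20 * N * (N + 1) by rewrite !mulr_gt0.
have rho0 : 0 < rho by rewrite divr_gt0.
have E : N * (N + 1) * rho = e / 20.
  by rewrite /rho; field; rewrite !gt_eqF.
have NNrho : N * rho <= N * (N + 1) * rho.
  by rewrite ler_pM2r// ler_peMr ?(ltW N0)//; lra.
have rhoN : rho <= N * rho by rewrite ler_peMl ?(ltW rho0).
have NK (w : 'rV[R]_d) (M : 'M[R]_(d, m)) c : 0 <= c -> `|M| <= K * c ->
    `|w *m M| <= N * `|w| * c.
  move=> c0 Mc; rewrite (le_trans (norm_mulmx_le _ _))//.
  rewrite (@le_trans _ _ (d%:R * `|w| * (K * c)))//; first by rewrite ler_wpM2l ?mulr_ge0.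
  have -> : d%:R * `|w| * (K * c) = d%:R * K * `|w| * c by ring.
  by rewrite ler_wpM2r// ler_wpM2r// lerDl.
have [|||||||| g [g0 Hg]] := @frobenius_core R m d F s0 r0 N e rho.
- by rewrite e0.
- by rewrite rho0 /=; lra.
- by lra.
- by [].
- by lra.
- by rewrite E; lra.
- move=> x x' xe xe'; have [dF B1 B2 B3 B4] := He x x' xe xe'; split=> // w.
  + by have := NK w (F x) 1 ler01; rewrite !mulr1; apply.
  + exact: NK.
  + by move=> u; exact: NK.
  + by apply: NK => //; rewrite exprn_ge0.
- by move=> q /Hbe /HV[].
pose U := [set r : 'rV[R]_d | `|r - r0| < rho].
have oU : open U.
  rewrite (_ : U = ball r0 rho); first exact: ball_open.
  by apply/seteqP; split=> r; rewrite /U -ball_normE /ball_ /= distrC.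
have Ur0 : U r0 by rewrite /U /= subrr normr0.
exists g; split=> //; last by apply: (open_near oU Ur0) => r /Hg[].
apply: (open_smooth_near oU Ur0).
apply: (@total_differential_smooth _ _ _ F g U V) => // r /Hg[] //.
by move=> /Hbe.
Qed.

(** * Smooth maps into manifolds *)

Lemma nbhs_smooth_near (R : realType) n (W : normedModType R) (U : set 'rV[R]_n)
    (F : 'rV[R]_n -> W) x :
  nbhs x U -> smooth_on U F -> smooth_near F x.
Proof.
move=> xU sF; apply: near_imp xU => y Uy k; apply: Ck_on_sub (sF k) => z ->.
exact: Uy.
Qed.

Section Charts.
Context {R : realType} {M : topologicalType} {p : nat}.
Implicit Types (k : chart R M p).

Lemma nbhs_dom k x : is_chart k -> dom k x -> nbhs x (dom k).
Proof. by move=> ck kx; apply: open_nbhs_nbhs; split=> //; exact: open_dom ck. Qed.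

Lemma nbhs_cod k z : is_chart k -> cod k z -> nbhs z (cod k).
Proof. by move=> ck kz; apply: open_nbhs_nbhs; split=> //; exact: open_cod ck. Qed.

Lemma cod_coord k x : dom k x -> cod k (coord k x).
Proof. by move=> kx; exists x. Qed.

Lemma coord_pointK k x : is_chart k -> dom k x -> point k (coord k x) = x.
Proof. by move=> ck kx; apply: (coordK ck); apply/mem_set. Qed.

Lemma dom_point k z : is_chart k -> cod k z -> dom k (point k z).
Proof. by move=> ck [x kx <-]; rewrite coord_pointK. Qed.

Lemma point_coordK k z : is_chart k -> cod k z -> coord k (point k z) = z.
Proof. by move=> ck [x kx <-]; rewrite coord_pointK. Qed.

Lemma chart_continuous_point k z : is_chart k -> cod k z -> {for z, continuous (point k)}.
Proof. by move=> ck kz; apply: (continuous_point ck); apply/mem_set. Qed.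

Lemma chart_continuous_coord k x : is_chart k -> dom k x -> {for x, continuous (coord k)}.
Proof. by move=> ck kx; apply: (continuous_coord ck); apply/mem_set. Qed.

(** Smoothness is tested in one chart, continuity keeping nearby values inside its domain;
    [smooth_param_chart] shows that any chart around the value gives the same. *)
Definition smooth_param n (S : set (chart R M p)) (f : 'rV[R]_n -> M) x :=
  exists k, [/\ S k, dom k (f x), {for x, continuous f} & smooth_near (coord k \o f) x].

End Charts.

Section SmoothMaps.
Context {R : realType} {M N : topologicalType} {p q : nat}.
Variables (S : set (chart R M p)) (T : set (chart R N q)).
Hypothesis S_chart : forall k, S k -> is_chart k.
Hypothesis T_chart : forall l, T l -> is_chart l.

(** Near x the composite factors through the chart k, and smoothness of F in the charts k, l
    applies; continuity makes the factorization valid on a neighbourhood. *)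
Lemma smooth_map_param_chart n (F : M -> N) (f : 'rV[R]_n -> M) x l :
  smooth_map_on S T setT F -> smooth_param S f x -> T l -> dom l (F (f x)) ->
  smooth_near (coord l \o (F \o f)) x.
Proof.
move=> [Fc Fs] [k [Sk kfx fc sk]] Tl lFx; have ck := S_chart Sk.
have Fc' y : {for y, continuous F} by apply: Fc; exact/mem_set.
have kx := cod_coord kfx.
have nU : nbhs (coord k (f x)) (coord k @` (setT `&` dom k `&` F @^-1` dom l)).
  have Fp : {for coord k (f x), continuous (F \o point k)}.
    exact: (continuous_comp (chart_continuous_point ck kx) (Fc' _)).
  have : nbhs (F (point k (coord k (f x)))) (dom l).
    by rewrite coord_pointK//; exact: nbhs_dom (T_chart Tl) lFx.
  move=> /Fp nl; apply: near_imp (near_and (nbhs_cod ck kx) nl) => z [kz lz].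
  exists (point k z); last exact: point_coordK.
  by split=> //; split=> //; exact: dom_point.
have sF := nbhs_smooth_near nU (Fs k l Sk Tl).
apply: smooth_near_eq (smooth_near_comp sk sF).
have : nbhs x (f @^-1` dom k) by apply: fc; exact: nbhs_dom.
by apply: near_imp => y ky /=; rewrite coord_pointK.
Qed.

Lemma smooth_map_param n (F : M -> N) (f : 'rV[R]_n -> M) x :
  smooth_map_on S T setT F -> (forall y, exists2 l, T l & dom l y) ->
  smooth_param S f x -> smooth_param T (F \o f) x.
Proof.
move=> FS cover fx; have [l Tl lFx] := cover (F (f x)).
exists l; split=> //.
  have [Fc _] := FS; have [k [_ _ fc _]] := fx.
  by apply: (continuous_comp fc); apply: Fc; exact/mem_set.
exact: smooth_map_param_chart FS fx Tl lFx.
Qed.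

End SmoothMaps.

Section SmoothParam.
Context {R : realType} {M : topologicalType} {p : nat}.
Variable S : set (chart R M p).
Hypothesis S_manifold : smooth_manifold S.

Let S_chart := atlas_chart S_manifold.

(** In charts the identity is a transition map; independence of the chart is then the case F = id of
    [smooth_map_param_chart]. *)
Lemma smooth_map_id : smooth_map_on S S setT id.
Proof.
split=> [x _|k l Sk Sl]; first exact: cvg_id.
by rewrite setTI; exact: (atlas_compatible S_manifold).
Qed.

Lemma smooth_param_chart n (f : 'rV[R]_n -> M) x k :
  smooth_param S f x -> S k -> dom k (f x) -> smooth_near (coord k \o f) x.
Proof. by move=> fx; apply: (smooth_map_param_chart S_chart S_chart smooth_map_id fx). Qed.

Lemma smooth_param_continuous n (f : 'rV[R]_n -> M) x :
  smooth_param S f x -> {for x, continuous f}.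
Proof. by case=> k []. Qed.

Lemma smooth_param_cst n (a : M) (x : 'rV[R]_n) : smooth_param S (cst a) x.
Proof.
have [k Sk ka] := atlas_cover S_manifold a.
exists k; split=> //; first exact: cst_continuous.
exact: (smooth_near_cst (coord k a) x).
Qed.

Lemma smooth_param_point k z : S k -> cod k z -> smooth_param S (point k) z.
Proof.
move=> Sk kz; have ck := S_chart Sk; exists k; split=> //.
- exact: dom_point.
- exact: chart_continuous_point.
apply: smooth_near_eq (smooth_near_id z).
by apply: near_imp (nbhs_cod ck kz) => y ky /=; rewrite point_coordK.
Qed.

Lemma smooth_param_comp n n' (f : 'rV[R]_n -> M) (h : 'rV[R]_n' -> 'rV[R]_n) x :
  smooth_near h x -> smooth_param S f (h x) -> smooth_param S (f \o h) x.
Proof.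
move=> sh [k [Sk kf fc sf]]; exists k; split=> //.
  exact: (continuous_comp (smooth_near_continuous sh) fc).
exact: (smooth_near_comp sh sf).
Qed.

End SmoothParam.

(** * Product charts and smooth maps into a Lie group *)

Section ProductCharts.
Context {R : realType} {M N : topologicalType} {p q : nat}.

Lemma continuous_row_mx (T : topologicalType) n1 n2 (f : T -> 'rV[R]_n1)
    (g : T -> 'rV[R]_n2) x :
  {for x, continuous f} -> {for x, continuous g} ->
  {for x, continuous (fun y => row_mx (f y) (g y))}.
Proof.
move=> cf cg; apply: continuous_mx => i j; case: (split_ordP j) => k ->.
  have -> : (fun y => row_mx (f y) (g y) i (lshift n2 k)) = (fun y => f y i k).
    by apply/funext => y; rewrite row_mxEl.
  exact: (continuous_comp cf (@coord_continuous R 1 n1 i k (f x))).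
have -> : (fun y => row_mx (f y) (g y) i (rshift n1 k)) = (fun y => g y i k).
  by apply/funext => y; rewrite row_mxEr.
exact: (continuous_comp cg (@coord_continuous R 1 n2 i k (g x))).
Qed.

Lemma continuous_pair (T : topologicalType) (f : T -> M) (g : T -> N) x :
  {for x, continuous f} -> {for x, continuous g} ->
  {for x, continuous (fun y => (f y, g y))}.
Proof. by move=> cf cg; exact: (cvg_pair cf cg). Qed.

Lemma prod_chart_is_chart (k : chart R M p) (l : chart R N q) :
  is_chart k -> is_chart l -> is_chart (prod_chart k l).
Proof.
move=> ck cl.
have codE : cod (prod_chart k l) =
    (lsubmx @^-1` cod k) `&` ((rsubmx : 'rV[R]_(p + q) -> _) @^-1` cod l).
  apply/seteqP; split=> [_ [[x y] [/= kx ly] <-]|z [/= [x kx xz] [y ly yz]]].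
    by split=> /=; rewrite ?row_mxKl ?row_mxKr; exact: cod_coord.
  by exists (x, y) => //=; rewrite xz yz hsubmxK.
split.
- apply: openI.
    by apply: open_comp (open_dom ck) => z _; exact: cvg_fst.
  by apply: open_comp (open_dom cl) => z _; exact: cvg_snd.
- rewrite codE; apply: openI.
    by apply: open_comp (open_cod ck) => z _; exact: continuous_lsubmx.
  by apply: open_comp (open_cod cl) => z _; exact: continuous_rsubmx.
- move=> [x y] /set_mem[/= kx ly] /=.
  by rewrite row_mxKl row_mxKr !coord_pointK.
- move=> [x y] /set_mem[/= kx ly].
  apply: (@continuous_row_mx (M * N)%type p q (coord k \o fst) (coord l \o snd)).
    have fc : {for (x, y), continuous (@fst M N)} by exact: cvg_fst.
    exact: (continuous_comp fc (chart_continuous_coord ck kx)).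
  have sc : {for (x, y), continuous (@snd M N)} by exact: cvg_snd.
  exact: (continuous_comp sc (chart_continuous_coord cl ly)).
- move=> z /set_mem; rewrite codE => -[/= kz lz].
  apply: (@continuous_pair _ (point k \o lsubmx) (point l \o rsubmx)).
    exact: (continuous_comp (@continuous_lsubmx _ _ _ _ z) (chart_continuous_point ck kz)).
  exact: (continuous_comp (@continuous_rsubmx _ _ _ _ z) (chart_continuous_point cl lz)).
Qed.

Lemma smooth_param_pair (S : set (chart R M p)) (T : set (chart R N q)) n
    (f : 'rV[R]_n -> M) (g : 'rV[R]_n -> N) x :
  smooth_param S f x -> smooth_param T g x ->
  smooth_param (prod_atlas S T) (fun z => (f z, g z)) x.
Proof.
move=> [k [Sk kf fc sf]] [l [Tl lg gc sg]].
exists (prod_chart k l); split=> //.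
- by exists k => //; exists l.
- exact: continuous_pair.
exact: smooth_near_row_mx.
Qed.

End ProductCharts.

Section LieGroupParams.
Context {R : realType} {G : topGroupType} {m : nat}.
Variable S : set (chart R G m).
Hypothesis G_lie : lie_group S.

Lemma smooth_param_mul n (f g : 'rV[R]_n -> G) x :
  smooth_param S f x -> smooth_param S g x ->
  smooth_param S (fun z => (f z * g z)%g) x.
Proof.
have S_chart := atlas_chart (lie_manifold G_lie).
move=> sf sg.
apply: (smooth_map_param _ S_chart (lie_mul_smooth G_lie) _ (smooth_param_pair sf sg)).
  by move=> _ [k Sk [l Sl <-]]; apply: prod_chart_is_chart; exact: S_chart.
exact: atlas_cover (lie_manifold G_lie).
Qed.

Lemma smooth_param_inv n (f : 'rV[R]_n -> G) x :
  smooth_param S f x -> smooth_param S (fun z => (f z)^-1%g) x.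
Proof.
have S_chart := atlas_chart (lie_manifold G_lie).
apply: (smooth_map_param S_chart S_chart (lie_inv_smooth G_lie)).
exact: atlas_cover (lie_manifold G_lie).
Qed.

End LieGroupParams.

(** * The Maurer-Cartan equation *)

Section Jacobians.
Context {R : realType}.

Lemma mulmx_rV_inj p q (A B : 'M[R]_(p, q)) :
  (forall v : 'rV[R]_p, v *m A = v *m B) -> A = B.
Proof. by move=> AB; apply/row_matrixP => i; rewrite !rowE. Qed.

Lemma jac_comp n p q (f : 'rV[R]_n -> 'rV[R]_p) (g : 'rV[R]_p -> 'rV[R]_q) x :
  differentiable f x -> differentiable g (f x) ->
  jac (g \o f) x = jac f x *m jac g (f x).
Proof.
move=> df dg; have dgf : differentiable (g \o f) x by exact: differentiable_comp.
apply: mulmx_rV_inj => v; rewrite mulmxA -(derive_jac v df).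
by rewrite -(derive_jac _ dg) -(derive_jac v dgf) (derive_comp v df dg).
Qed.

Lemma jac_near n p (f g : 'rV[R]_n -> 'rV[R]_p) x :
  (\forall y \near x, f y = g y) -> jac f x = jac g x.
Proof.
move=> fg; apply/matrixP => i j; rewrite !mxE /partial.
by have -> := near_eq_derive (delta_mx 0 i) fg.
Qed.

Lemma jac_id n (x : 'rV[R]_n) : jac id x = 1%:M.
Proof.
apply: mulmx_rV_inj => v; rewrite mulmx1 -derive_jac; last exact: ex_diff.
exact: derive_id.
Qed.

Lemma jac_slice n1 n2 p (nu : 'rV[R]_(n1 + n2) -> 'rV[R]_p) s t :
  smooth_near nu (row_mx s t) ->
  jac (fun y => nu (row_mx s y)) t =
  \matrix_(i, j) 'D_(row_mx 0 (delta_mx 0 i)) nu (row_mx s t) 0 j.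
Proof.
move=> snu; have dnu := smooth_near_diff snu.
have di : differentiable (@id 'rV[R]_n2) t by exact: ex_diff.
apply/matrixP => i j; rewrite !mxE.
have [dr Dr] := differentiable_row_mx (delta_mx 0 i) (differentiable_cst s t) di.
have E := derive_comp (delta_mx 0 i) dr dnu.
rewrite Dr derive_cst derive_id in E.
by rewrite /partial -E.
Qed.

(** In [theta] the variable is both a parameter of the differentiated map and the point of
    differentiation. Writing the partial Jacobian with directional derivatives of the map of both
    variables makes it smooth. *)
Lemma smooth_near_jac_slice n n1 n2 p (nu : 'rV[R]_(n1 + n2) -> 'rV[R]_p)
    (u : 'rV[R]_n -> 'rV[R]_n1) (v : 'rV[R]_n -> 'rV[R]_n2) x :
  smooth_near u x -> smooth_near v x -> smooth_near nu (row_mx (u x) (v x)) ->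
  smooth_near (fun z => jac (fun y => nu (row_mx (u z) y)) (v z)) x.
Proof.
move=> su sv snu; have suv := smooth_near_row_mx su sv.
have nnu : \forall z \near x, smooth_near nu (row_mx (u z) (v z)).
  exact: (smooth_near_continuous suv) (smooth_near_near snu).
pose J z : 'M[R]_(n2, p) := \matrix_(i, j)
  'D_(row_mx 0 (delta_mx 0 i)) nu (row_mx (u z) (v z)) 0 j.
apply: (@smooth_near_eq _ _ _ J).
  by apply: near_imp nnu => z snz; rewrite jac_slice.
apply/smooth_near_mxP => i j.
have sD : smooth_near ('D_(row_mx 0 (delta_mx 0 i)) nu) (row_mx (u x) (v x)).
  exact: (smooth_near_derive_mx snu (smooth_near_cst _ _)).
have /smooth_near_mxP /(_ 0 j) := smooth_near_comp suv sD.
by apply: smooth_near_eq; apply: near_all => z; rewrite mxE.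
Qed.

End Jacobians.

Section MaurerCartan.
Context {R : realType} {G : topGroupType} {m : nat}.
Variable S : set (chart R G m).
Hypothesis G_lie : lie_group S.
Variable k0 : chart R G m.
Hypothesis k0_chart : S k0.
Hypothesis k0_one : dom k0 (1%g : G).

Let S_manifold := lie_manifold G_lie.
Let e0 := coord k0 1%g.

Lemma cod_e0 : cod k0 e0. Proof. exact: cod_coord. Qed.

Lemma point_e0 : point k0 e0 = 1%g.
Proof. exact: coord_pointK (atlas_chart S_manifold k0_chart) k0_one. Qed.

(** Read in k at the source and in k0 at the target, since T_1 G is identified with row vectors
    through k0. *)
Definition left_transl (k : chart R G m) (a : G) : 'rV[R]_m -> 'rV[R]_m :=
  fun y => coord k0 (a * point k y)%g.

(** The Maurer-Cartan form g^-1 dg. *)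
Definition theta (k : chart R G m) (s : 'rV[R]_m) : 'M[R]_m :=
  jac (left_transl k (point k s)^-1%g) s.

(** The differential at 1 of left translation by g; its rows are left-invariant vector fields. *)
Definition lambda (k : chart R G m) (s : 'rV[R]_m) : 'M[R]_m :=
  jac (fun y => coord k (point k s * point k0 y)%g) e0.

Lemma smooth_mu k z : S k -> cod k (lsubmx z) -> cod k (rsubmx z) ->
  dom k0 ((point k (lsubmx z))^-1 * point k (rsubmx z))%g ->
  smooth_near (fun z : 'rV[R]_(m + m) =>
    coord k0 ((point k (lsubmx z))^-1 * point k (rsubmx z))%g) z.
Proof.
move=> Sk lz rz dz.
apply: (smooth_param_chart S_manifold (f := fun z : 'rV[R]_(m + m) =>
  ((point k (lsubmx z))^-1 * point k (rsubmx z))%g)) => //.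
apply: (smooth_param_mul G_lie).
  apply: (smooth_param_inv G_lie).
  exact: (smooth_param_comp (smooth_near_lsubmx z) (smooth_param_point S_manifold Sk lz)).
exact: (smooth_param_comp (smooth_near_rsubmx z) (smooth_param_point S_manifold Sk rz)).
Qed.

Lemma smooth_theta k s : S k -> cod k s -> smooth_near (theta k) s.
Proof.
move=> Sk ks.
have snu : smooth_near (fun z : 'rV[R]_(m + m) =>
    coord k0 ((point k (lsubmx z))^-1 * point k (rsubmx z))%g) (row_mx s s).
  by apply: smooth_mu; rewrite ?row_mxKl ?row_mxKr ?mulVg.
have := smooth_near_jac_slice (smooth_near_id s) (smooth_near_id s) snu.
apply: smooth_near_eq; apply: near_all => z; rewrite /theta; congr (jac _ z).
by apply/funext => y; rewrite row_mxKl row_mxKr.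
Qed.

Lemma smooth_lambda k s : S k -> cod k s -> smooth_near (lambda k) s.
Proof.
move=> Sk ks; have ck := atlas_chart S_manifold Sk.
have snu : smooth_near (fun z : 'rV[R]_(m + m) =>
    coord k (point k (lsubmx z) * point k0 (rsubmx z))%g) (row_mx s e0).
  apply: (smooth_param_chart S_manifold (f := fun z : 'rV[R]_(m + m) =>
    (point k (lsubmx z) * point k0 (rsubmx z))%g)) => //; last first.
    by rewrite row_mxKl row_mxKr point_e0 mulg1; exact: dom_point.
  apply: (smooth_param_mul G_lie).
    apply: (smooth_param_comp (smooth_near_lsubmx _)).
    by apply: (smooth_param_point S_manifold Sk); rewrite row_mxKl.
  apply: (smooth_param_comp (smooth_near_rsubmx _)).
  by apply: (smooth_param_point S_manifold k0_chart); rewrite row_mxKr; exact: cod_e0.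
have H := smooth_near_jac_slice (smooth_near_id s) (smooth_near_cst e0 s) snu.
suff -> : lambda k = fun z => jac (fun y => (fun z : 'rV[R]_(m + m) =>
  coord k (point k (lsubmx z) * point k0 (rsubmx z))%g) (row_mx z y)) e0 by [].
apply/funext => z; rewrite /lambda; congr (jac _ e0).
by apply/funext => y; rewrite row_mxKl row_mxKr.
Qed.

Lemma smooth_left_transl k a s : S k -> cod k s -> dom k0 (a * point k s)%g ->
  smooth_near (left_transl k a) s.
Proof.
move=> Sk ks ds.
apply: (smooth_param_chart S_manifold (f := fun y => (a * point k y)%g)) => //.
apply: (smooth_param_mul G_lie); first exact: smooth_param_cst.
exact: smooth_param_point.
Qed.

Lemma left_velocityE (E : 'M[R]_m) k s ds : S k -> cod k s ->
  left_velocity k0 E k s ds = ds *m theta k s *m invmx E.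
Proof.
move=> Sk ks; rewrite /left_velocity; congr (_ *m _).
apply: (@derive_jac _ _ _ (left_transl k (point k s)^-1%g)).
by apply/smooth_near_diff/smooth_left_transl; rewrite // mulVg.
Qed.

(** Chain rule for translation by g followed by translation by g^-1, a composite that is the
    identity near 1. *)
Lemma lambda_theta k s : S k -> cod k s -> lambda k s *m theta k s = 1%:M.
Proof.
move=> Sk ks; have ck := atlas_chart S_manifold Sk.
have c0 := atlas_chart S_manifold k0_chart.
set g := point k s.
pose f y : 'rV[R]_m := coord k (g * point k0 y)%g.
have fp : smooth_param S (fun y => (g * point k0 y)%g) e0.
  apply: (smooth_param_mul G_lie); first exact: smooth_param_cst.
  by apply: smooth_param_point => //; exact: cod_e0.
have fe0 : f e0 = s by rewrite /f point_e0 mulg1 /g point_coordK.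
have df : dom k (g * point k0 e0)%g by rewrite point_e0 mulg1; exact: dom_point.
have sf : smooth_near f e0.
  exact: (smooth_param_chart S_manifold (f := fun y => (g * point k0 y)%g)).
have sl : smooth_near (left_transl k g^-1%g) (f e0).
  by rewrite fe0; apply: smooth_left_transl => //; rewrite mulVg.
have := jac_comp (smooth_near_diff sf) (smooth_near_diff sl).
rewrite /lambda -/g /theta -/g -/f fe0 => <-.
rewrite -[RHS](jac_id e0); apply: jac_near.
have nd : nbhs e0 ((fun y => (g * point k0 y)%g) @^-1` dom k).
  by apply: (smooth_param_continuous fp); exact: nbhs_dom.
apply: near_imp (near_and nd (nbhs_cod c0 cod_e0)) => y [ky y0] /=.
by rewrite /left_transl /f coord_pointK// mulKg point_coordK.
Qed.

Lemma theta_unit k s : S k -> cod k s -> theta k s \in unitmx.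
Proof. by move=> Sk ks; have /mulmx1_unit[] := lambda_theta Sk ks. Qed.

Lemma lambda_e0 : lambda k0 e0 = 1%:M.
Proof.
have c0 := atlas_chart S_manifold k0_chart.
rewrite /lambda -[RHS](jac_id e0); apply: jac_near.
apply: near_imp (nbhs_cod c0 cod_e0) => y y0.
by rewrite point_e0 mul1g point_coordK.
Qed.

Lemma theta_e0 : theta k0 e0 = 1%:M.
Proof. by have := lambda_theta k0_chart cod_e0; rewrite lambda_e0 mul1mx. Qed.

Lemma left_invariant_fieldE v x : cod k0 x ->
  left_invariant_field k0 v x = v *m lambda k0 x.
Proof.
move=> kx; apply: (@derive_jac _ _ _ (left_transl k0 (point k0 x))).
apply/smooth_near_diff/smooth_left_transl => //; first exact: cod_e0.
rewrite point_e0 mulg1; exact: (dom_point (atlas_chart S_manifold k0_chart) kx).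
Qed.

(** At 1 both [theta] and [lambda] are the identity matrix, so differentiating their constant
    product gives opposite derivatives; those of [lambda] are the derivatives of the left-invariant
    fields in the bracket. *)
Lemma maurer_cartan_one v w : ext_form (theta k0) e0 v w = lie_bracket k0 v w.
Proof.
have dL := smooth_near_diff (smooth_lambda k0_chart cod_e0).
have dT := smooth_near_diff (smooth_theta k0_chart cod_e0).
have c0 := atlas_chart S_manifold k0_chart.
have D u : 'D_u (theta k0) e0 = - 'D_u (lambda k0) e0.
  have H := derive_mulmx u dL dT.
  rewrite theta_e0 lambda_e0 mulmx1 mul1mx in H.
  have E : 'D_u (fun y => lambda k0 y *m theta k0 y) e0 = 0.
    have n1 : \forall y \near e0, lambda k0 y *m theta k0 y = cst 1%:M y.
      by apply: near_imp (nbhs_cod c0 cod_e0) => y y0; rewrite lambda_theta.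
    by apply: etrans (near_eq_derive u n1) _; exact: derive_cst.
  by apply/eqP; rewrite -addr_eq0 addrC -H E.
have F u u' : 'D_u' (left_invariant_field k0 u) e0 = u *m 'D_u' (lambda k0) e0.
  rewrite -derive_mulmxl//; apply: near_eq_derive.
  apply: near_imp (nbhs_cod c0 cod_e0) => y.
  exact: left_invariant_fieldE.
have L u : left_invariant_field k0 u e0 = u.
  by rewrite left_invariant_fieldE ?lambda_e0 ?mulmx1//; exact: cod_e0.
have -> : lie_bracket k0 v w = w *m 'D_v (lambda k0) e0 - v *m 'D_w (lambda k0) e0.
  by rewrite /lie_bracket /vf_bracket (L v) (L w) (F w v) (F v w).
by rewrite /ext_form (D v) (D w) !mulmxN opprK addrC.
Qed.

(** Left invariance of the Maurer-Cartan form: for fixed a, translation by a followed by translation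
    by (a h)^-1 is translation by h^-1. *)
Lemma theta_pullback k s : S k -> cod k s ->
  \forall y \near s, theta k y =
    jac (left_transl k (point k s)^-1%g) y *m
    theta k0 (left_transl k (point k s)^-1%g y).
Proof.
move=> Sk ks; have ck := atlas_chart S_manifold Sk.
have c0 := atlas_chart S_manifold k0_chart.
set a := (point k s)^-1%g.
have ap : smooth_param S (fun y => (a * point k y)%g) s.
  apply: (smooth_param_mul G_lie); first exact: smooth_param_cst.
  exact: smooth_param_point.
have nd : nbhs s ((fun y => (a * point k y)%g) @^-1` dom k0).
  apply: (smooth_param_continuous ap); apply: nbhs_dom => //.
  by rewrite mulVg.
have [U [oU Us HU]] := near_open (near_and nd (nbhs_cod ck ks)).
apply: (open_near oU Us) => y Uy; have [dy ky] := HU y Uy.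
have s1 : smooth_near (left_transl k a) y by exact: smooth_left_transl.
have cy : cod k0 (left_transl k a y) by exact: cod_coord.
have pE z : U z -> point k0 (left_transl k a z) = (a * point k z)%g.
  by move=> /HU[dz _]; rewrite /left_transl coord_pointK.
set b := (point k0 (left_transl k a y))^-1%g.
have s2 : smooth_near (left_transl k0 b) (left_transl k a y).
  by apply: smooth_left_transl; rewrite // /b mulVg.
rewrite /theta -/b -(jac_comp (smooth_near_diff s1) (smooth_near_diff s2)).
apply: jac_near; apply: (open_near oU Uy) => z Uz.
by rewrite /= [in RHS]/left_transl pE// /b pE// /left_transl invgM -mulgA mulKg.
Qed.

Lemma smooth_transition_near k k' s : S k -> S k' -> cod k s -> dom k' (point k s) ->
  smooth_near (coord k' \o point k) s.
Proof.
by move=> Sk Sk' ks ds; apply: (smooth_param_chart S_manifold) => //;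
  exact: smooth_param_point.
Qed.

Lemma theta_change k k' s : S k -> S k' -> cod k s -> dom k' (point k s) ->
  theta k s = jac (coord k' \o point k) s *m theta k' (coord k' (point k s)).
Proof.
move=> Sk Sk' ks ds; have ck := atlas_chart S_manifold Sk.
have ck' := atlas_chart S_manifold Sk'.
have st := smooth_transition_near Sk Sk' ks ds.
have cs : cod k' (coord k' (point k s)) by exact: cod_coord.
have pE : point k' (coord k' (point k s)) = point k s by rewrite coord_pointK.
have sl : smooth_near (left_transl k' (point k s)^-1%g) (coord k' (point k s)).
  by apply: smooth_left_transl; rewrite // pE mulVg.
rewrite /theta pE -(jac_comp (smooth_near_diff st) (smooth_near_diff sl)).
have nd : nbhs s (point k @^-1` dom k').
  by apply: (chart_continuous_point ck ks); exact: nbhs_dom.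
apply: jac_near; apply: near_imp nd => y dy.
by rewrite /left_transl /= coord_pointK.
Qed.

(* Left translation by [g^-1] pulls the form [g^-1 dg] back to itself, which   *)
(* reduces the Maurer-Cartan equation at [g] to the one at the identity.       *)
Lemma maurer_cartan k s v w : S k -> cod k s ->
  ext_form (theta k) s v w = lie_bracket k0 (v *m theta k s) (w *m theta k s).
Proof.
move=> Sk ks; have ck := atlas_chart S_manifold Sk.
set f := left_transl k (point k s)^-1%g.
have fs : f s = e0 by rewrite /f /left_transl mulVg.
have sf : smooth_near f s by apply: smooth_left_transl; rewrite // mulVg.
have dT : differentiable (theta k0) (f s).
  by rewrite fs; apply/smooth_near_diff/smooth_theta => //; exact: cod_e0.
have P := theta_pullback Sk ks; rewrite -/f in P.
rewrite (ext_form_near _ _ P) (ext_form_pullback _ _ sf dT) fs.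
by rewrite maurer_cartan_one !(derive_jac _ (smooth_near_diff sf)).
Qed.

End MaurerCartan.

Section ExtFormBilinear.
Context {R : realType} {n p : nat}.
Variables (M : 'rV[R]_n -> 'M[R]_(n, p)) (q : 'rV[R]_n).
Hypothesis dM : differentiable M q.

Lemma ext_formC v w : ext_form M q v w = - ext_form M q w v.
Proof. by rewrite /ext_form opprB. Qed.

Lemma ext_form_suml d (x : 'rV[R]_d) (E : 'M[R]_(d, n)) w :
  ext_form M q (x *m E) w = \sum_b x 0 b *: ext_form M q (row b E) w.
Proof.
have D : 'D_(x *m E) M q = \sum_b x 0 b *: 'D_(row b E) M q.
  rewrite deriveE// (mulmx_sum_row x E) linear_sum; apply: eq_bigr => b _.
  by rewrite linearZ /= deriveE.
rewrite {1}/ext_form D (mulmx_sum_row x E) mulmx_suml mulmx_sumr -sumrB.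
apply: eq_bigr => b _.
by rewrite /ext_form -scalemxAl -scalemxAr scalerBr.
Qed.

Lemma ext_form_sumr d (y : 'rV[R]_d) (E : 'M[R]_(d, n)) v :
  ext_form M q v (y *m E) = \sum_b y 0 b *: ext_form M q v (row b E).
Proof.
rewrite ext_formC ext_form_suml -sumrN; apply: eq_bigr => b _.
by rewrite -scalerN -ext_formC.
Qed.

End ExtFormBilinear.

(** * The constraint distribution *)

Section MaurerCartanComponents.
Context {R : realType} {G : topGroupType} {m : nat}.
Variable S : set (chart R G m).
Hypothesis G_lie : lie_group S.
Variable k0 : chart R G m.
Hypotheses (k0_chart : S k0) (k0_one : dom k0 (1%g : G)).
Variable E : 'M[R]_m.
Hypothesis E_basis : E \in unitmx.
Variable c : 'I_m -> 'I_m -> 'I_m -> R.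
Hypothesis c_struct : structure_constants k0 E c.

(** By [maurer_cartan_one] the bracket is the value of a two-form at 1; this supplies the
    bilinearity that reduces it to brackets of basis vectors. *)
Lemma lie_bracket_components (x y : 'rV[R]_m) a :
  (lie_bracket k0 (x *m E) (y *m E) *m invmx E) 0 a =
  \sum_b \sum_e x 0 b * y 0 e * c b e a.
Proof.
have dT := smooth_near_diff
  (smooth_theta G_lie k0_chart k0_one k0_chart (cod_e0 k0_one)).
rewrite -(maurer_cartan_one G_lie k0_chart k0_one) (ext_form_suml dT) mulmx_suml summxE.
apply: eq_bigr => b _; rewrite (ext_form_sumr dT) -scalemxAl mxE mulmx_suml summxE mulr_sumr.
apply: eq_bigr => e _; rewrite -scalemxAl mxE mulrA; congr (_ * _).
rewrite (maurer_cartan_one G_lie k0_chart k0_one) c_struct.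
rewrite mulmx_suml summxE (bigD1 a)//= big1 ?addr0.
  by rewrite -scalemxAl mxE rowE -mulmxA mulmxV// mulmx1 mxE !eqxx mulr1.
move=> i ia; rewrite -scalemxAl mxE rowE -mulmxA mulmxV// mulmx1 mxE.
by rewrite eqxx eq_sym (negbTE ia) mulr0.
Qed.

End MaurerCartanComponents.

Lemma exchange_big_pairs (R : nmodType) (I J : finType) (F : I -> I -> J -> J -> R) :
  \sum_b \sum_e \sum_i \sum_j F b e i j = \sum_i \sum_j \sum_b \sum_e F b e i j.
Proof.
rewrite pair_bigA /= [RHS]pair_bigA /=.
under eq_bigr do rewrite pair_bigA /=.
by rewrite exchange_big; apply: eq_bigr => ij _; rewrite pair_bigA.
Qed.

Lemma sum_delta_mx2 (R : comNzRingType) (d : nat) (F : 'I_d -> 'I_d -> R) i j :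
  \sum_i' \sum_j' F i' j' * (delta_mx 0 i : 'rV_d) 0 i' * (delta_mx 0 j : 'rV_d) 0 j' =
  F i j.
Proof.
rewrite (bigD1 i)//= [X in _ + X]big1 => [|i' ii'].
  rewrite addr0 (bigD1 j)//= [X in _ + X]big1 => [|j' jj'].
    by rewrite !mxE !eqxx addr0 !mulr1.
  by rewrite !mxE eqxx (negbTE jj') mulr0.
by apply: big1 => j' _; rewrite !mxE eqxx (negbTE ii') mulr0 mul0r.
Qed.

Lemma smooth_near_tr (R : realType) n p q (F : 'rV[R]_n -> 'M[R]_(p, q)) x :
  smooth_near F x -> smooth_near (fun y => (F y)^T) x.
Proof.
move=> /smooth_near_mxP sF; apply/smooth_near_mxP => i j.
by apply: smooth_near_eq (sF j i); apply: near_all => y; rewrite mxE.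
Qed.

Section ConstraintForm.
Context {R : realType} {G : topGroupType} {m d : nat} {V : topologicalType}.
Variables (S : set (chart R G m)) (T : set (chart R V d)).
Hypotheses (G_lie : lie_group S) (V_manifold : smooth_manifold T).
Variable k0 : chart R G m.
Hypotheses (k0_chart : S k0) (k0_one : dom k0 (1%g : G)).
Variable E : 'M[R]_m.
Hypothesis E_basis : E \in unitmx.
Variable c : 'I_m -> 'I_m -> 'I_m -> R.
Hypothesis c_struct : structure_constants k0 E c.
Variable A : chart R V d -> 'rV[R]_d -> 'M[R]_(m, d).
Hypothesis A_form : smooth_one_form T A.

Let S_manifold := lie_manifold G_lie.

(** Its columns are the one-forms u^alpha: it is the transpose of the upper rows of
    [constraint_coframe]. *)
Definition constraint_form (k : chart R G m) (l : chart R V d) (q : 'rV[R]_(m + d)) :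
    'M[R]_(m + d, m) :=
  col_mx (theta k0 k (lsubmx q) *m invmx E) (A l (rsubmx q))^T.

Lemma mul_constraint_form k l (X q : 'rV[R]_(m + d)) :
  X *m constraint_form k l q =
  lsubmx X *m theta k0 k (lsubmx q) *m invmx E + rsubmx X *m (A l (rsubmx q))^T.
Proof. by rewrite -{1}[X]hsubmxK mul_row_col mulmxA. Qed.

Lemma smooth_A l r : T l -> cod l r -> smooth_near (A l) r.
Proof.
move=> Tl lr; have [sA _] := A_form; apply/smooth_near_mxP => a i.
exact: nbhs_smooth_near (nbhs_cod (atlas_chart V_manifold Tl) lr) (sA l a i Tl).
Qed.

Section AtPoint.
Variables (k : chart R G m) (l : chart R V d).
Hypotheses (Sk : S k) (Tl : T l).
Variable q : 'rV[R]_(m + d).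
Hypotheses (kq : cod k (lsubmx q)) (lq : cod l (rsubmx q)).

Let dtheta := smooth_near_diff (smooth_theta G_lie k0_chart k0_one Sk kq).

Lemma differentiable_AT : differentiable (fun r => (A l r)^T) (rsubmx q).
Proof.
by have [] := differentiable_tr 0 (smooth_near_diff (smooth_A Tl lq)).
Qed.

Lemma differentiable_thetaE :
  differentiable (fun s => theta k0 k s *m invmx E) (lsubmx q).
Proof. exact: differentiable_mulmx dtheta (differentiable_cst _ _). Qed.

Lemma differentiable_constraint_form : differentiable (constraint_form k l) q.
Proof.
have dl : differentiable (lsubmx : _ -> 'rV[R]_m) q by exact: differentiable_lsubmx.
have dr : differentiable (rsubmx : _ -> 'rV[R]_d) q by exact: differentiable_rsubmx.
have d1 := differentiable_comp dl differentiable_thetaE.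
have d2 := differentiable_comp dr differentiable_AT.
by have [] := differentiable_col_mx 0 d1 d2.
Qed.

(** When u kills X, its group part satisfies theta(X) = - (A X) E. The Maurer-Cartan term is then
    the bracket of two such values; their signs cancel, and c A A is added to the antisymmetrized
    derivative of A. *)
Lemma ext_constraint_form X Y a :
  X *m constraint_form k l q = 0 -> Y *m constraint_form k l q = 0 ->
  ext_form (constraint_form k l) q X Y 0 a =
  \sum_i \sum_j curvature c A l a i j (rsubmx q) * rsubmx X 0 i * rsubmx Y 0 j.
Proof.
move=> X0 Y0.
rewrite (ext_form_col_mx _ _ differentiable_thetaE differentiable_AT).
rewrite (ext_form_mulmxr _ _ _ dtheta) (maurer_cartan G_lie k0_chart k0_one _ _ Sk kq).
have vE (Z : 'rV[R]_(m + d)) : Z *m constraint_form k l q = 0 ->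
    lsubmx Z *m theta k0 k (lsubmx q) = (- (rsubmx Z *m (A l (rsubmx q))^T)) *m E.
  rewrite mul_constraint_form => /eqP; rewrite addr_eq0 => /eqP <-.
  by rewrite mulmxKV.
rewrite (vE X X0) (vE Y Y0) [LHS]mxE.
rewrite (lie_bracket_components G_lie k0_chart k0_one E_basis c_struct).
rewrite (ext_formE _ _ a differentiable_AT) addrC.
(* The derivative part and the structure constant part are kept apart until the quadruple sum has
   been reordered. *)
transitivity (\sum_i \sum_j (partial j (fun r => A l r a i) (rsubmx q)
    - partial i (fun r => A l r a j) (rsubmx q)) * rsubmx X 0 i * rsubmx Y 0 j +
  \sum_i \sum_j \sum_b \sum_e
    (c b e a * A l (rsubmx q) b i * A l (rsubmx q) e j * rsubmx X 0 i * rsubmx Y 0 j)).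
  congr (_ + _).
    apply: eq_bigr => i _; apply: eq_bigr => j _.
    have tr i' : (fun r => (A l r)^T i' a) = (fun r => A l r a i').
      by apply/funext => r; rewrite mxE.
    by rewrite (tr i) (tr j).
  rewrite -exchange_big_pairs; apply: eq_bigr => b _; apply: eq_bigr => e _.
  rewrite [X in X * _ * _]mxE [X in _ * X * _]mxE mulrNN !mxE big_distrlr mulr_suml.
  apply: eq_bigr => i _; rewrite mulr_suml; apply: eq_bigr => j _.
  by rewrite !mxE /=; ring.
rewrite -big_split; apply: eq_bigr => i _; rewrite -big_split; apply: eq_bigr => j _ /=.
rewrite /curvature [in RHS]mulrDl [in RHS]mulrDl; congr (_ + _).
rewrite mulr_suml mulr_suml; apply: eq_bigr => b _.
by rewrite mulr_suml mulr_suml.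
Qed.

(** The group velocity is - g (A v): [E] turns components into a vector of T_1 G, which [lambda]
    translates to g. *)
Definition horizontal_lift (v : 'rV[R]_d) : 'rV[R]_(m + d) :=
  row_mx (- (v *m (A l (rsubmx q))^T *m E *m lambda k0 k (lsubmx q))) v.

Lemma horizontal_lift_form v : horizontal_lift v *m constraint_form k l q = 0.
Proof.
have LT := lambda_theta G_lie k0_chart k0_one Sk kq.
rewrite mul_constraint_form /horizontal_lift row_mxKl row_mxKr.
set B := v *m (A l (rsubmx q))^T.
by rewrite !mulNmx -(mulmxA (B *m E)) LT mulmx1 mulmxK// addNr.
Qed.

(** As [theta] and E are invertible, u = 0 determines the group part of a vector from its base
    part. *)
Lemma constraint_form_inj (X Y : 'rV[R]_(m + d)) :
  X *m constraint_form k l q = 0 -> Y *m constraint_form k l q = 0 ->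
  rsubmx X = rsubmx Y -> X = Y.
Proof.
rewrite !mul_constraint_form => X0 Y0 XY.
rewrite -[X]hsubmxK -[Y]hsubmxK XY; congr row_mx.
have tu := theta_unit G_lie k0_chart k0_one Sk kq.
rewrite -(mulmxK tu (lsubmx X)) -(mulmxK tu (lsubmx Y)); congr (_ *m _).
rewrite -(mulmxKV E_basis (lsubmx X *m _)) -(mulmxKV E_basis (lsubmx Y *m _)).
congr (_ *m _); apply: (addIr (rsubmx Y *m (A l (rsubmx q))^T)).
by rewrite -{1}XY X0 Y0.
Qed.

Lemma constraint_coframeE : constraint_coframe k0 E A k l q =
  (row_mx (constraint_form k l q) (col_mx 0 1%:M))^T.
Proof.
rewrite tr_row_mx !tr_col_mx trmxK trmx0 trmx1 /constraint_coframe block_mxEv.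
congr (col_mx (row_mx _ _) _); apply/matrixP => a b; rewrite [LHS]mxE [RHS]mxE.
rewrite (left_velocityE G_lie k0_chart k0_one _ _ Sk kq).
by rewrite -mulmxA -rowE [LHS]mxE.
Qed.

Lemma constraint_spaceP X :
  constraint_space k0 E A k l q X <-> X *m constraint_form k l q = 0.
Proof.
have qv a : quasi_velocity (constraint_coframe k0 E A k l) q X (lshift d a) =
    (X *m constraint_form k l q) 0 a.
  rewrite /quasi_velocity constraint_coframeE mxE; apply: eq_bigr => b _.
  by rewrite mxE row_mxEl mulrC.
split=> [XC|X0 a]; last by rewrite qv X0 mxE.
by apply/rowP => a; rewrite -qv XC mxE.
Qed.

Lemma constraint_coframe_unit : constraint_coframe k0 E A k l q \in unitmx.
Proof.
have -> : constraint_coframe k0 E A k l q =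
    block_mx (theta k0 k (lsubmx q) *m invmx E)^T (A l (rsubmx q)) 0 1%:M.
  rewrite constraint_coframeE tr_row_mx !tr_col_mx trmxK trmx0 trmx1.
  by rewrite block_mxEv.
rewrite unitmxE det_ublock det1 mulr1 -unitmxE unitmx_tr unitmx_mul.
by rewrite (theta_unit G_lie k0_chart k0_one Sk kq) unitmx_inv.
Qed.

End AtPoint.

(** * Hamel coefficients, flatness and holonomicity *)

Implicit Types (k : chart R G m) (l : chart R V d).

Lemma cod_prod_chart k l (q : 'rV[R]_(m + d)) : cod (prod_chart k l) q ->
  cod k (lsubmx q) /\ cod l (rsubmx q).
Proof.
by move=> [[g v] [/= kg lv] <-]; rewrite row_mxKl row_mxKr; split; exact: cod_coord.
Qed.

(** The columns of the inverse coframe with base indices are killed by u and have coordinate vectors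
    as base parts, so the double sum of [ext_constraint_form] collapses to one term. *)
Lemma hamel_curvature k l q a i j : S k -> T l -> cod (prod_chart k l) q ->
  hamel (constraint_coframe k0 E A k l) (rshift m i) (rshift m j) (lshift d a) q =
  curvature c A l a i j (rsubmx q).
Proof.
move=> Sk Tl /cod_prod_chart[kq lq].
have ck := atlas_chart S_manifold Sk; have cl := atlas_chart V_manifold Tl.
pose B x : 'M[R]_(m + d, m + d) := row_mx (constraint_form k l x) (col_mx 0 1%:M).
have dM := differentiable_constraint_form Sk Tl kq lq.
(* The matrix form of the coframe is known over the chart images only, so derivatives are compared
   through equality near q. *)
have nB : \forall x \near q, (B x)^T = constraint_coframe k0 E A k l x.
  have nl : nbhs q ((lsubmx : 'rV[R]_(m + d) -> _) @^-1` cod k).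
    by apply: (@continuous_lsubmx _ _ _ _ q); exact: nbhs_cod.
  have nr : nbhs q ((rsubmx : 'rV[R]_(m + d) -> _) @^-1` cod l).
    by apply: (@continuous_rsubmx _ _ _ _ q); exact: nbhs_cod.
  by apply: near_imp (near_and nl nr) => x [kx lx]; rewrite (constraint_coframeE l Sk).
have dC0 := differentiable_cst (col_mx 0 1%:M : 'M[R]_(m + d, d)) q.
have dB v := differentiable_row_mx v dM dC0.
have dBT := (differentiable_tr 0 (dB 0).1).1.
have dC : differentiable (constraint_coframe k0 E A k l) q.
  exact: near_eq_differentiable nB dBT.
rewrite hamel_ext_form//.
have nBT : \forall x \near q, (constraint_coframe k0 E A k l x)^T = B x.
  by apply: near_imp nB => x <-; rewrite trmxK.
rewrite (ext_form_near _ _ nBT).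
have XE b : (col (rshift m b) (invmx (constraint_coframe k0 E A k l q)))^T *m
    constraint_form k l q = 0 /\
    rsubmx (col (rshift m b) (invmx (constraint_coframe k0 E A k l q)))^T =
    delta_mx 0 b :> 'rV[R]_d.
  set Z := _^T.
  have ZE : Z *m B q = delta_mx 0 (rshift m b).
    rewrite -[B q]trmxK (nbhs_singleton nB) -trmx_mul colE mulmxA mulmxV.
      by rewrite mul1mx trmx_delta.
    exact: (constraint_coframe_unit l Sk kq).
  rewrite /B mul_mx_row in ZE.
  have Zr : Z *m col_mx 0 1%:M = rsubmx Z.
    by rewrite -{1}[Z]hsubmxK mul_row_col mulmx0 add0r mulmx1.
  rewrite Zr in ZE; split.
    rewrite -(row_mxKl (Z *m constraint_form k l q) (rsubmx Z)) ZE.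
    by apply/rowP => x; rewrite !mxE eq_lrshift andbF.
  rewrite -(row_mxKr (Z *m constraint_form k l q) (rsubmx Z)) ZE.
  by apply/rowP => x; rewrite !mxE eq_rshift.
have [X0 Xr] := XE i; have [Y0 Yr] := XE j.
(* The dr block of the coframe is constant; the component with group index a comes from the
   constraint columns. *)
have EB u v : ext_form B q u v 0 (lshift d a) = ext_form (constraint_form k l) q u v 0 a.
  rewrite /ext_form (dB u).2 (dB v).2 !derive_cst !mul_mx_row !mulmx0.
  by rewrite opp_row_mx add_row_mx row_mxEl.
rewrite EB (ext_constraint_form Sk Tl kq lq a X0 Y0) Xr Yr.
by rewrite sum_delta_mx2.
Qed.

Lemma holonomic_flat : holonomic S T k0 E A -> flat T c A.
Proof.
move=> hol l r Tl lr a i j.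
have cl := atlas_chart V_manifold Tl; have c0 := atlas_chart S_manifold k0_chart.
(* The integral manifold is taken through the identity over r, where [k0] is a chart of G. *)
have [W [f [oW [x0 Wx0 fx0] _ [fc fs] ftan]]] := hol (1%g, point l r).
pose P := prod_chart k0 l.
have cP : is_chart P by exact: prod_chart_is_chart.
have Pf : dom P (f x0) by rewrite fx0; split=> //=; exact: dom_point.
have fc0 : {for x0, continuous f} by apply: fc; exact/mem_set.
have nW : nbhs x0 W by exact: open_nbhs_nbhs.
have nP : nbhs x0 (f @^-1` dom P) by apply: fc0; exact: nbhs_dom.
pose h := coord P \o f.
have sh : smooth_near h x0.
  have PT : prod_atlas S T P by exists k0 => //; exists l.
  have Et : @euclidean_atlas R d (Chart setT id id) by [].
  apply: nbhs_smooth_near (fs _ _ Et PT).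
  by apply: near_imp (near_and nW nP) => x [Wx Px]; exists x => //; split.
have kq x : dom P (f x) -> cod k0 (lsubmx (h x)) /\ cod l (rsubmx (h x)).
  by move=> [kx lx]; rewrite /h /= row_mxKl row_mxKr; split; exact: cod_coord.
have [k0q lq] := kq _ Pf.
(* Tangency to the distribution says that u pulls back to 0 near x0, hence so does its exterior
   derivative. *)
have nh : \forall x \near x0, jac h x *m constraint_form k0 l (h x) = cst 0 x.
  apply: near_imp (near_and (near_and nW nP) (smooth_near_near sh)) => x.
  move=> [[Wx Px] /smooth_near_diff dh]; have [k0x lx] := kq x Px.
  apply: mulmx_rV_inj => v; rewrite mulmxA -derive_jac// mulmx0.
  apply/(constraint_spaceP l k0_chart k0x).
  by rewrite -(ftan x k0 l Wx k0_chart Tl Px); exists v.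
have dM := differentiable_constraint_form k0_chart Tl k0q lq.
have e0 v w : ext_form (constraint_form k0 l) (h x0) ('D_v h x0) ('D_w h x0) = 0.
  rewrite -ext_form_pullback// (ext_form_near _ _ nh) /ext_form !derive_cst.
  by rewrite !mulmx0 subrr.
(* The equality of tangent spaces is used in the other direction: every horizontal lift is tangent
   to the integral manifold. *)
have lift b : exists v, 'D_v h x0 = horizontal_lift k0 l (h x0) (delta_mx 0 b).
  have : constraint_space k0 E A k0 l (h x0) (horizontal_lift k0 l (h x0) (delta_mx 0 b)).
    by apply/(constraint_spaceP l k0_chart k0q); exact: horizontal_lift_form.
  by rewrite -(ftan x0 k0 l Wx0 k0_chart Tl Pf) => -[v _ <-]; exists v.
have [v vE] := lift i; have [w wE] := lift j.
have := ext_constraint_form k0_chart Tl k0q lq a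
  (horizontal_lift_form l k0_chart k0q (delta_mx 0 i))
  (horizontal_lift_form l k0_chart k0q (delta_mx 0 j)).
rewrite -vE -wE e0 vE wE /horizontal_lift !row_mxKr mxE.
rewrite sum_delta_mx2.
have -> : coord l (f x0).2 = r by rewrite fx0 /= point_coordK.
exact: esym.
Qed.

Lemma connection_change l l' x : T l -> T l' -> cod l x -> dom l' (point l x) ->
  (A l x)^T = jac (coord l' \o point l) x *m (A l' (coord l' (point l x)))^T.
Proof.
move=> Tl Tl' lx dx; have cl := atlas_chart V_manifold Tl.
have [_ Ach] := A_form.
apply/matrixP => i a; rewrite !mxE.
rewrite -{1}(point_coordK cl lx) (Ach l l') //; last exact: dom_point.
by apply: eq_bigr => j _; rewrite !mxE point_coordK// mulrC.
Qed.

Lemma smooth_horizontal k l q : S k -> T l -> cod k (lsubmx q) -> cod l (rsubmx q) ->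
  smooth_near (fun x : 'rV[R]_(m + d) =>
    (A l (rsubmx x))^T *m (- E) *m lambda k0 k (lsubmx x)) q.
Proof.
move=> Sk Tl kq lq; apply: smooth_near_mulmx.
  apply: smooth_near_mulmx; last exact: smooth_near_cst.
  apply: smooth_near_tr.
  exact: (smooth_near_comp (smooth_near_rsubmx q) (smooth_A Tl lq)).
exact: (smooth_near_comp (smooth_near_lsubmx q)
  (smooth_lambda G_lie k0_chart k0_one Sk kq)).
Qed.

Lemma near_cods k l q : S k -> T l -> cod k (lsubmx q) -> cod l (rsubmx q) ->
  \forall x \near q, cod k (lsubmx x) /\ cod l (rsubmx x).
Proof.
move=> Sk Tl kq lq; apply: near_and.
  apply: (@continuous_lsubmx _ _ _ _ q).
  exact: nbhs_cod (atlas_chart S_manifold Sk) kq.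
apply: (@continuous_rsubmx _ _ _ _ q).
exact: nbhs_cod (atlas_chart V_manifold Tl) lq.
Qed.

(** The rows of [N] are horizontal, so the product of [N] with the constraint form M vanishes near
    q, and differentiating moves the derivative from [N] to M up to sign. After antisymmetrization
    the M side is an exterior derivative on horizontal vectors, zero by flatness. So the
    antisymmetrized derivative of [N] is killed by u; its base part is 0, hence it is 0. *)
Lemma flat_integrable k l q : flat T c A ->
  S k -> T l -> cod k (lsubmx q) -> cod l (rsubmx q) ->
  let F := fun x : 'rV[R]_(m + d) =>
    (A l (rsubmx x))^T *m (- E) *m lambda k0 k (lsubmx x) in
  forall v w, w *m 'D_(lift_dir F q v) F q = v *m 'D_(lift_dir F q w) F q.
Proof.
move=> fl Sk Tl kq lq F v w.
have dF : differentiable F q by exact: smooth_near_diff (smooth_horizontal Sk Tl kq lq).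
have dM := differentiable_constraint_form Sk Tl kq lq.
pose N x : 'M[R]_(d, m + d) := row_mx (F x) 1%:M.
have dN u := differentiable_row_mx u dF (differentiable_cst (1%:M : 'M[R]_d) q).
have liftE x u : lift_dir F x u = u *m N x by rewrite mul_mx_row mulmx1.
have liftH x u : lift_dir F x u = horizontal_lift k l x u.
  by rewrite /lift_dir /horizontal_lift /F mulmxN mulNmx mulmxN !mulmxA.
have nN : \forall x \near q, N x *m constraint_form k l x = cst 0 x.
  apply: near_imp (near_cods Sk Tl kq lq) => x [kx lx].
  apply: mulmx_rV_inj => u; rewrite mulmxA -liftE liftH mulmx0.
  exact: horizontal_lift_form.
have DN u : 'D_u N q *m constraint_form k l q = - (N q *m 'D_u (constraint_form k l) q).
  have := derive_mulmx u (dN u).1 dM.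
  have -> : 'D_u (fun y => row_mx (F y) (cst 1%:M y) *m constraint_form k l y) q = 0.
    by apply: etrans (near_eq_derive u nN) _; exact: derive_cst.
  by move=> /esym/eqP; rewrite addr_eq0 => /eqP.
have DNE u : 'D_u N q = row_mx ('D_u F q) 0.
  by apply: etrans (dN u).2 _; rewrite derive_cst.
have LM u : lift_dir F q u *m constraint_form k l q = 0.
  by rewrite liftH; exact: horizontal_lift_form.
have e0 : ext_form (constraint_form k l) q (lift_dir F q w) (lift_dir F q v) = 0.
  apply/rowP => i; rewrite [RHS]mxE.
  apply: etrans (ext_constraint_form Sk Tl kq lq i (LM w) (LM v)) _.
  by apply: big1 => i' _; apply: big1 => j' _; rewrite fl// !mul0r.
have e1 := subr0_eq e0.
have ND x y : x *m 'D_y N q *m constraint_form k l q =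
    - (lift_dir F q x *m 'D_y (constraint_form k l) q).
  by rewrite -mulmxA (DN y) mulmxN mulmxA -(liftE q x).
have Z : (w *m 'D_(lift_dir F q v) N q - v *m 'D_(lift_dir F q w) N q) *m
    constraint_form k l q = 0.
  rewrite mulmxBl; apply/eqP; rewrite subr_eq0; apply/eqP.
  apply: etrans (ND w _) _; apply: etrans (esym (ND v _)).
  exact: congr1 e1.
apply/eqP; rewrite -subr_eq0; apply/eqP.
have := constraint_form_inj Sk kq Z (mul0mx _ _).
rewrite !DNE !mul_mx_row !mulmx0 opp_row_mx add_row_mx subr0 row_mxKr.
have -> : rsubmx (0 : 'rV[R]_(m + d)) = 0 by apply/rowP => j; rewrite !mxE.
move=> /(_ erefl) /(congr1 lsubmx); rewrite row_mxKl => ->.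
by apply/rowP => j; rewrite !mxE.
Qed.

(** The opposite transition map is a local inverse, so the Jacobian is invertible. *)
Lemma transition_onto l l' x (w : 'rV[R]_d) :
  T l -> T l' -> cod l x -> dom l' (point l x) ->
  exists v, 'D_v (coord l' \o point l) x = w.
Proof.
move=> Tl Tl' lx dx; have cl := atlas_chart V_manifold Tl.
have cl' := atlas_chart V_manifold Tl'.
pose f := coord l' \o point l; pose g := coord l \o point l'.
have lfx : cod l' (f x) by exact: cod_coord.
have pfx : point l' (f x) = point l x by rewrite /f /= coord_pointK.
have dlx : dom l (point l x) by exact: dom_point.
have sf : smooth_near f x.
  by apply: (smooth_param_chart V_manifold) => //; exact: smooth_param_point.
have sg : smooth_near g (f x).
  apply: (smooth_param_chart V_manifold) => //; last by rewrite pfx.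
  exact: smooth_param_point.
have sf' : smooth_near f (g (f x)) by rewrite /g /= pfx point_coordK.
have := jac_comp (smooth_near_diff sg) (smooth_near_diff sf').
rewrite (_ : g (f x) = x); last by rewrite /g /= pfx point_coordK.
have -> : jac (f \o g) (f x) = 1%:M.
  rewrite -(jac_id (f x)); apply: jac_near.
  have nd : nbhs (f x) (point l' @^-1` dom l).
    apply: (chart_continuous_point cl' lfx); rewrite pfx; exact: nbhs_dom.
  apply: near_imp (near_and nd (nbhs_cod cl' lfx)) => y [dy ly].
  by rewrite /f /g /= coord_pointK// point_coordK.
move=> J1; exists (w *m jac g (f x)).
by rewrite (derive_jac _ (smooth_near_diff sf)) -mulmxA -J1 mulmx1.
Qed.

(** Tangency passes from one pair of charts to the others because theta and A transform as
    one-forms. Conversely a vector killed by u is determined by its base part, which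
    [transition_onto] realizes by a tangent vector. *)
Lemma integral_tangent k l k' l' (g : 'rV[R]_d -> 'rV[R]_m) x :
  S k -> T l -> S k' -> T l' ->
  cod k (g x) -> cod l x -> dom k' (point k (g x)) -> dom l' (point l x) ->
  smooth_near g x ->
  (forall v, row_mx ('D_v g x) v *m constraint_form k l (row_mx (g x) x) = 0) ->
  let h := fun y => row_mx (coord k' (point k (g y))) (coord l' (point l y)) in
  range (fun v : 'rV[R]_d => 'D_v h x) = constraint_space k0 E A k' l' (h x).
Proof.
move=> Sk Tl Sk' Tl' kg lx dk dl sg tan h.
have sk := smooth_transition_near G_lie Sk Sk' kg dk.
have sl : smooth_near (coord l' \o point l) x.
  by apply: (smooth_param_chart V_manifold) => //; exact: smooth_param_point.
have dkg : differentiable ((coord k' \o point k) \o g) x.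
  exact: differentiable_comp (smooth_near_diff sg) (smooth_near_diff sk).
have Dh v : 'D_v h x = row_mx ('D_v g x *m jac (coord k' \o point k) (g x))
    (v *m jac (coord l' \o point l) x).
  apply: etrans (differentiable_row_mx v dkg (smooth_near_diff sl)).2 _.
  congr row_mx; last exact: derive_jac (smooth_near_diff sl).
  apply: etrans (derive_comp v (smooth_near_diff sg) (smooth_near_diff sk)) _.
  exact: derive_jac (smooth_near_diff sk).
have k'h : cod k' (lsubmx (h x)) by rewrite row_mxKl; exact: cod_coord.
have Dh0 v : 'D_v h x *m constraint_form k' l' (h x) = 0.
  rewrite Dh mul_constraint_form !row_mxKl !row_mxKr.
  rewrite -[X in X *m invmx E]mulmxA -(theta_change G_lie k0_chart k0_one Sk Sk' kg dk).
  rewrite -[X in _ + X]mulmxA -(connection_change Tl Tl' lx dl).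
  by have := tan v; rewrite mul_constraint_form !row_mxKl !row_mxKr.
apply/seteqP; split=> [_ [v _ <-]|X].
  by apply/(constraint_spaceP l' Sk' k'h).
move=> /(constraint_spaceP l' Sk' k'h) X0.
have [v vE] := transition_onto (rsubmx X) Tl Tl' lx dl.
exists v => //; apply: (constraint_form_inj Sk' k'h (Dh0 v) X0).
by rewrite Dh row_mxKr -vE derive_jac//; exact: smooth_near_diff.
Qed.

(** The integral manifold is the graph of the solution given by [frobenius], parametrized by the
    base coordinates, whence its injectivity. *)
Lemma flat_holonomic : flat T c A -> holonomic S T k0 E A.
Proof.
move=> fl [g0 v0].
have [k Sk kg0] := atlas_cover S_manifold g0.
have [l Tl lv0] := atlas_cover V_manifold v0.
have ck := atlas_chart S_manifold Sk; have cl := atlas_chart V_manifold Tl.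
have ks0 := cod_coord kg0; have lr0 := cod_coord lv0.
set s0 := coord k g0 in ks0; set r0 := coord l v0 in lr0.
(* This is u = 0 solved for the group velocity: ds = - (A dr) E lambda. *)
pose F (x : 'rV[R]_(m + d)) := (A l (rsubmx x))^T *m (- E) *m lambda k0 k (lsubmx x).
have kq : cod k (lsubmx (row_mx s0 r0)) by rewrite row_mxKl.
have lq : cod l (rsubmx (row_mx s0 r0)) by rewrite row_mxKr.
have Fint : \forall q \near row_mx s0 r0, forall v w,
    w *m 'D_(lift_dir F q v) F q = v *m 'D_(lift_dir F q w) F q.
  by apply: near_imp (near_cods Sk Tl kq lq) => q [kx lx]; exact: flat_integrable.
have [g [g0E sg gD]] := frobenius (smooth_horizontal Sk Tl kq lq) Fint.
have ng : nbhs r0 (g @^-1` cod k).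
  by apply: (smooth_near_continuous sg); rewrite g0E; exact: nbhs_cod.
have [W [oW Wr0 HW]] := near_open (near_and (near_and ng (nbhs_cod cl lr0))
  (near_and (smooth_near_near sg) gD)).
have fk x : W x -> smooth_param S (point k \o g) x.
  move=> /HW[[kx _] [sx _]].
  exact: (smooth_param_comp sx (smooth_param_point S_manifold Sk kx)).
have fl' x : W x -> smooth_param T (point l) x.
  by move=> /HW[[_ lx] _]; exact: smooth_param_point.
exists W, (fun r => (point k (g r), point l r)); split=> //.
- by exists r0 => //; rewrite g0E /s0 /r0 !coord_pointK.
- move=> x y /set_mem /HW[[_ lx] _] /set_mem /HW[[_ ly] _] [_ xy].
  by rewrite -(point_coordK cl lx) -(point_coordK cl ly) xy.
- split=> [x /set_mem Wx|_ _ -> [k' Sk' [l' Tl' <-]]].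
    exact: (@continuous_pair _ _ _ _ _ x (smooth_param_continuous (fk x Wx))
      (smooth_param_continuous (fl' x Wx))).
  apply: smooth_near_on => _ [x [[Wx _] [/= dk dl]] <-].
  apply: smooth_near_row_mx.
    exact: (smooth_param_chart S_manifold (fk x Wx) Sk' dk).
  exact: (smooth_param_chart V_manifold (fl' x Wx) Tl' dl).
- move=> x k' l' Wx Sk' Tl' [/= dk dl]; have [[kx lx] [sx Dx]] := HW x Wx.
  apply: (integral_tangent Sk Tl Sk' Tl' kx lx dk dl sx) => v.
  rewrite Dx.
  have kq' : cod k (lsubmx (row_mx (g x) x)) by rewrite row_mxKl.
  rewrite -(horizontal_lift_form l Sk kq' v) /horizontal_lift; congr (row_mx _ _ *m _).
  by rewrite mulmxN mulNmx mulmxN !mulmxA.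
Qed.

End ConstraintForm.

Theorem proposition4p1 (R : realType) (m d : nat)
    (G : topGroupType) (S : set (chart R G m)) (G_lie : lie_group S)
    (V : topologicalType) (T : set (chart R V d)) (V_manifold : smooth_manifold T)
    (k0 : chart R G m) (k0_chart : S k0) (k0_one : dom k0 (1%g : G))
    (E : 'M[R]_m) (E_basis : E \in unitmx)
    (c : 'I_m -> 'I_m -> 'I_m -> R) (c_struct : structure_constants k0 E c)
    (A : chart R V d -> 'rV[R]_d -> 'M[R]_(m, d)) (A_form : smooth_one_form T A) :
  (forall (k : chart R G m) (l : chart R V d), S k -> T l ->
   forall q : 'rV[R]_(m + d), cod (prod_chart k l) q ->
   forall (a : 'I_m) (i j : 'I_d),
     hamel (constraint_coframe k0 E A k l)
           (rshift m i) (rshift m j) (lshift d a) q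
     = partial j (fun r => A l r a i) (rsubmx q)
       - partial i (fun r => A l r a j) (rsubmx q)
       + \sum_b \sum_e c b e a * A l (rsubmx q) b i * A l (rsubmx q) e j
     /\
     curvature c A l a i j (rsubmx q)
     = hamel (constraint_coframe k0 E A k l)
             (rshift m i) (rshift m j) (lshift d a) q)
  /\ (flat T c A <-> holonomic S T k0 E A).
Proof.
have H := hamel_curvature G_lie V_manifold k0_chart k0_one E_basis c_struct A_form.
split=> [k l Sk Tl q kq a i j|]; first by rewrite H.
by split; [exact: flat_holonomic|exact: holonomic_flat].
Qed.
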